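(* There is a random variable $W$ such that $W_{2n}\to W$ in distribution as $n\to\infty$. There are two cases. (a) If $f$ is the identity function on $[0,1]$, then $W_{2n}\sim U[0,1]$ for all $n$. (b) Otherwise, let $Q$ be the set of fixed points of $f$ in $[0,1]$ which are unstable from at least one side. Then $W$ is discrete and has atoms precisely at the elements of $Q$. Moreover, for each $q\in Q$, $\mathbb{P}(W=q)=q_+-q_-$, where $$q_-=\begin{cases}\sup\{x: x<q,\ x=f(x)\} & \text{if } q>0 \text{ and } q \text{ is unstable from the left},\\ q & \text{otherwise,}\end{cases}$$ $$q_+=\begin{cases}\inf\{x: x>q,\ x=f(x)\} & \text{if } q<1 \text{ and } q \text{ is unstable from the right},\\ q & \text{otherwise.}\end{cases}$$
   Context: Let $(p_k)_{k\ge 1}$ be a probability mass function on $\{1,2,3,\dots\}$ (the offspring distribution), $G(x)=\sum_{k\ge1}p_kx^k$ for $x\in[0,1]$ its probability generating function, $R(x)=1-G(x)$ and $f(x)=R(R(x))$ for $x\in[0,1]$. ($G$ and $f$ are increasing bijections of $[0,1]$, $R$ is a decreasing one.) Write $f^n$ for the $n$-fold composition of $f$. The random variable $W_{2n}$ is the minimax value at the root of a Galton–Watson tree with this offspring distribution truncated at level $2n$ (the root is level $0$), where the leaves at level $2n$ carry i.i.d. $U[0,1]$ values independent of the tree, each node at an odd level gets the maximum of its children's values, and each non-leaf node at an even level gets the minimum of its children's values. Equivalently $W_0\sim U[0,1]$ and for $n\ge1$ $$W_{2n}\stackrel{d}{=}\min_{1\le i\le M}\ \max_{1\le j\le M_i}W^{(i,j)}_{2n-2},$$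 where $M,M_1,M_2,\dots$ are i.i.d. draws from the offspring distribution, and $W^{(i,j)}_{2n-2}$ are i.i.d. copies of $W_{2n-2}$ independent of $M,M_1,M_2,\dots$. A fixed point $q\in[0,1]$ of $f$ is unstable from the right if $q<1$ and $\lim_{\epsilon\downarrow0}\lim_{n\to\infty}f^n(q+\epsilon)>q$; it is unstable from the left if $q>0$ and $\lim_{\epsilon\downarrow0}\lim_{n\to\infty}f^n(q-\epsilon)<q$. In the definitions of $q_\pm$, $x$ ranges over $[0,1]$. *)

(* Defs.v *)
From HB Require Import structures.
From mathcomp Require Import all_boot all_order all_algebra finmap.
From mathcomp Require Import all_classical all_reals all_analysis.
From mathcomp Require Import measurable_realfun.

Set Implicit Arguments.
Unset Strict Implicit.
Unset Printing Implicit Defensive.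

Import Order.TTheory GRing.Theory Num.Theory.
Import numFieldNormedType.Exports.

Local Open Scope classical_set_scope.
Local Open Scope ring_scope.

Section offspring.
Context {R : realType}.
Implicit Types (p : nat -> R) (f : R -> R) (q x : R).

(* [p k] is the probability of having [k] children; as the offspring
   distribution lives on {1, 2, ...}, [p 0 = 0]. *)
Definition offspring_pmf p : Prop :=
  [/\ p 0%N = 0, forall k, 0 <= p k & (\sum_(1 <= k <oo) (p k)%:E = 1)%E].

(* The functions G, R and f are only meaningful on [0, 1]. *)
Definition pgf p x : R := \big[+%R/0]_(1 <= k <oo) (p k * x ^+ k).

Definition pgf_compl p x : R := 1 - pgf p x.

Definition pgf_iter p x : R := pgf_compl p (pgf_compl p x).

Definition unstable_right f q : Prop :=
  q < 1 /\ q < lim (limn (fun n => iter n f (q + e)) @[e --> 0^'+]).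

Definition unstable_left f q : Prop :=
  0 < q /\ lim (limn (fun n => iter n f (q - e)) @[e --> 0^'+]) < q.

Definition unstable_fixpoints f : set R :=
  [set q | [/\ 0 <= q <= 1, f q = q & unstable_right f q \/ unstable_left f q]].

Definition fix_below f q : R :=
  if `[< unstable_left f q >]
  then sup [set x | [/\ 0 <= x <= 1, x < q & x = f x]] else q.

Definition fix_above f q : R :=
  if `[< unstable_right f q >]
  then inf [set x | [/\ 0 <= x <= 1, q < x & x = f x]] else q.

End offspring.

Section minimax_tree.
Context {R : realType}.
Implicit Types (nchild : seq nat -> nat) (label : seq nat -> R) (v : seq nat).

(* Nodes are words (Ulam-Harris): the root is [::], the children of [v] are
   [rcons v j] for [j < nchild v], and the level of [v] is [size v].
   [minimax_value nchild label h v] is the value at [v] when the tree is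
   truncated [h] levels below [v], the nodes at that level being leaves
   carrying their label.  The initial value of the iterated max/min is the
   value of the first child, so it does not affect the result when
   [0 < nchild v]; [nchild v = 0] happens with probability zero below. *)
Fixpoint minimax_value nchild label (h : nat) v : R :=
  if h is h'.+1 then
    let x j := minimax_value nchild label h' (rcons v j) in
    if odd (size v) then \big[Num.max/x 0%N]_(j < nchild v) x j
    else \big[Num.min/x 0%N]_(j < nchild v) x j
  else label v.

End minimax_tree.

Section probability_notions.
Context {R : realType} {d : measure_display} {T : measurableType d}.
Variable P : probability T R.

(* Mutual independence of the classes of events [F i], [i] in [D]. *)
Definition mutually_independent (I : choiceType) (D : set I)
    (F : I -> set_system T) : Prop :=
  forall J : {fset I}, [set` J] `<=` D ->
  forall E : I -> set T, (forall i, i \in J -> F i (E i)) ->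
  P (\bigcap_(i in [set` J]) E i) = (\prod_(i <- J) P (E i))%E.

Definition uniform01 (X : {RV P >-> R}) : Prop :=
  forall A, measurable A -> distribution P X A = uniform_prob (@ltr01 R) A.

Definition cvg_in_distribution (X : nat -> {RV P >-> R})
    {d' : measure_display} {T' : measurableType d'} (P' : probability T' R)
    (Y : {RV P' >-> R}) : Prop :=
  forall x, {for x, continuous (cdf Y)} -> cdf (X n) x @[n --> \oo] --> cdf Y x.

(* Purely atomic law: being constrained only through its law, a limit in
   distribution is only required to be almost surely in a countable set. *)
Definition discrete_law (X : {RV P >-> R}) : Prop :=
  exists2 A, countable A & distribution P X A = 1%E.

End probability_notions.

(* [{RV P >-> R}] does not determine [P] by unification, hence [P] is explicit. *)
Arguments uniform01 {R d T} P X.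
Arguments cvg_in_distribution {R d T} P X {d' T'} P' Y.
Arguments discrete_law {R d T} P X.

Section minimax_variable.
Context {R : realType} {d : measure_display} {T : measurableType d}.
Context {P : probability T R}.
Variables (N : seq nat -> {RV P >-> nat}) (U : seq nat -> {RV P >-> R}).

Definition tree_sigma (i : seq nat + seq nat) : set_system T :=
  match i with
  | inl v => preimage_set_system setT (N v) measurable
  | inr v => preimage_set_system setT (U v) measurable
  end.

(* The offspring numbers are independent with law [p], and for every [n] the
   uniform labels of the nodes at level [2n] are independent, and independent
   of the offspring numbers.  Nothing is assumed on the joint law of labels at
   different levels, as each [W_2n] involves those of level [2n] only. *)
Definition minimax_data (p : nat -> R) : Prop :=
  [/\ forall v k, distribution P (N v) [set k] = (p k)%:E,
      forall v, uniform01 P (U v) &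
      forall n, mutually_independent P
        (range inl `|` inr @` [set v | size v = n.*2]) tree_sigma].

(* The random variable W_2n. *)
Definition minimax (n : nat) (t : T) : R :=
  minimax_value (fun v => N v t) (fun v => U v t) n.*2 [::].

Lemma measurable_bigop_random_ord (op : R -> R -> R) (M : {RV P >-> nat})
    (x : nat -> T -> R) :
  (forall f g : T -> R, measurable_fun setT f -> measurable_fun setT g ->
     measurable_fun setT (fun t => op (f t) (g t))) ->
  (forall j, measurable_fun setT (x j)) ->
  measurable_fun setT (fun t => \big[op/x 0%N t]_(j < M t) x j t).
Proof.
move=> mop mx.
have mM m : measurable (M @^-1` [set m]) by apply: measurable_funPTI.
have -> : [set: T] = \bigcup_m (M @^-1` [set m]).
  by apply/seteqP; split=> // t _; exists (M t).
apply/(measurable_fun_bigcup _ mM) => m.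
apply: (@eq_measurable_fun _ _ _ _ _ (fun t => \big[op/x 0%N t]_(j < m) x j t)).
  by move=> t /[!inE] /= ->.
apply: measurable_funTS; move: (x 0%N) (mx 0%N) => y my.
elim: m x mx => [|m IH] x mx.
  by under eq_fun do rewrite big_ord0.
under eq_fun do rewrite big_ord_recl.
by apply: mop => //; apply: (IH (fun j => x j.+1)).
Qed.

Lemma measurable_minimax n : measurable_fun setT (minimax n).
Proof.
rewrite /minimax; elim: n.*2 [::] => [|h IH] v /=.
  exact: measurable_funPT.
pose x j t := minimax_value (fun v => N v t) (fun v => U v t) h (rcons v j).
case: (odd (size v)).
- apply: (@measurable_bigop_random_ord Num.max (N v) x) => [f g|j].
    exact: measurable_maxr.
  exact: IH.
- apply: (@measurable_bigop_random_ord Num.min (N v) x) => [f g|j].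
    exact: measurable_minr.
  exact: IH.
Qed.

HB.instance Definition _ n :=
  isMeasurableFun.Build d _ T R (minimax n) (measurable_minimax n).

End minimax_variable.

(* Main.v *)
(** By independence of the subtrees, P(W_2n > x) and P(W_2n <= x) are obtained by
    applying alternately the generating function G and the complement 1 - ., hence the
    distribution function of W_2n on [0, 1] is the n-th iterate of f.  As f is
    increasing, f^n(x) converges monotonically to a fixed point L(x) of f, and the
    right-continuous version x |-> L(x+) of L is the distribution function of the limit
    W.  An atom of W at q has mass L(q+) - L(q-), and one-sided instability of a fixed
    point q means L(q+) > q or L(q-) < q, in which case L(q+) or L(q-) is the adjacent
    fixed point.  Away from the fixed points L is locally constant, so W is discrete
    as soon as f has countably many fixed points.

    If f is not the identity, then its fixed points in ]0, 1[ are isolated because f is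
    analytic there.  Analyticity is used in the following form: near a in ]0, 1[,
    f(a + h) is the pointwise limit of polynomials whose i-th coefficients are bounded
    by M / r^i.  These coefficients converge along an ultrafilter, and the first nonzero
    limit coefficient governs the behaviour of f(a + h) - (a + h) near h = 0. *)
From HB Require Import structures.
Require Import Defs.
From mathcomp Require Import all_boot all_order all_algebra finmap.
From mathcomp Require Import all_classical all_reals all_analysis.
From mathcomp Require Import measurable_realfun.
From mathcomp Require Import lra ring.

Set Implicit Arguments.
Unset Strict Implicit.
Unset Printing Implicit Defensive.

Import Order.TTheory GRing.Theory Num.Theory.
Import numFieldNormedType.Exports.

Local Open Scope classical_set_scope.
Local Open Scope ring_scope.

(** * Generating function and its partial sums *)

Section pgf.
Context {R : realType}.
Variable p : nat -> R.
Hypothesis hp : offspring_pmf p.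

Let p0 : p 0%N = 0. Proof. by case: hp. Qed.
Let p_ge0 k : 0 <= p k. Proof. by case: hp. Qed.

(** The partial sums are kept as polynomials so that they can later be composed and re-expanded
    around a point of ]0, 1[. Starting at index 0 rather than 1 changes nothing, as [p 0 = 0]. *)
Definition pgf_poly n : {poly R} := \poly_(k < n) p k.

Lemma horner_pgf_poly n x : (pgf_poly n).[x] = \sum_(k < n) p k * x ^+ k.
Proof. by rewrite horner_poly. Qed.

Lemma pgf_partial_sum x : (fun n => \sum_(1 <= k < n) p k * x ^+ k) =
  (fun n => (pgf_poly n).[x]).
Proof.
apply/funext => n; rewrite horner_pgf_poly.
case: n => [|n]; first by rewrite big_geq// big_ord0.
rewrite -(big_mkord xpredT (fun k => p k * x ^+ k)) [RHS]big_nat_recl//.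
by rewrite p0 mul0r add0r big_add1.
Qed.

Lemma pgf_poly_homo n m x : 0 <= x -> (n <= m)%N -> (pgf_poly n).[x] <= (pgf_poly m).[x].
Proof.
move=> x0 nm; rewrite !horner_pgf_poly -!(big_mkord xpredT (fun k => p k * x ^+ k)).
rewrite (big_cat_nat _ nm)//= lerDl; apply: sumr_ge0 => i _.
by rewrite mulr_ge0// exprn_ge0.
Qed.

Lemma pgf_poly1_cvg : (pgf_poly n).[1] @[n --> \oo] --> (1 : R).
Proof.
case: hp => _ _ s1.
have : (\sum_(1 <= k < n) (p k)%:E)%E @[n --> \oo] --> (1:R)%:E.
  rewrite -s1; 
  apply: is_cvg_nneseries => // n _ _; rewrite lee_fin//.
under eq_fun do rewrite sumEFin.
move=> /fine_cvg /=.
rewrite (_ : _ \o _ = fun n => (pgf_poly n).[1]) // -pgf_partial_sum.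
by apply/funext => n /=; apply: eq_bigr => i _; rewrite expr1n mulr1.
Qed.

Lemma pgf_poly_le n x y : 0 <= x <= y -> (pgf_poly n).[x] <= (pgf_poly n).[y].
Proof.
move=> /andP[x0 xy]; rewrite !horner_pgf_poly; apply: ler_sum => i _.
by rewrite ler_wpM2l// lerXn2r// nnegrE// (le_trans x0).
Qed.

Lemma pgf_poly1_le1 n : (pgf_poly n).[1] <= 1.
Proof.
rewrite -[leRHS](cvg_lim _ pgf_poly1_cvg)//.
apply: (@nondecreasing_cvgn_le _ (fun m => (pgf_poly m).[1])).
  by move=> a b ab; exact: pgf_poly_homo ler01 ab.
exact: cvgP pgf_poly1_cvg.
Qed.

Lemma pgf_poly_cvg x : 0 <= x <= 1 -> (pgf_poly n).[x] @[n --> \oo] --> pgf p x.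
Proof.
move=> /andP[x0 x1]; rewrite /pgf pgf_partial_sum.
apply: nondecreasing_is_cvgn; first by move=> a b ab; exact: pgf_poly_homo.
exists 1 => _ [n _ <-]; apply: le_trans (pgf_poly1_le1 n).
by apply: pgf_poly_le; rewrite x0.
Qed.

End pgf.

(** * Independence in the tree *)

Section tree.
Context {R : realType} {d : measure_display} {T : measurableType d}.
Context {P : probability T R}.
Variable N : seq nat -> {RV P >-> nat}.
Variable p : nat -> R.
Hypothesis hp : offspring_pmf p.

Implicit Types (s vs : seq (seq nat)) (k : seq nat -> nat) (A B : seq nat -> T -> bool).

Definition offspring_event s k (t : T) : bool := all (fun w => N w t == k w) s.

Definition all_event A vs (t : T) : bool := all (A^~ t) vs.

Lemma all_event_cat A vs ws t :
  all_event A (vs ++ ws) t = all_event A vs t && all_event A ws t.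
Proof. exact: all_cat. Qed.

(* The offspring numbers above level [l] and the events [A v] at level [l] are jointly
   independent, with probability [a] for each [A v]. *)
Definition level_indep l A (a : R) : Prop :=
  (forall v, measurable [set t | A v t]) /\
  forall s k vs, uniq s -> all (fun w => size w < l)%N s ->
    uniq vs -> all (fun v => size v == l) vs ->
    P [set t | offspring_event s k t && all_event A vs t] =
      ((\prod_(w <- s) p (k w)) * a ^+ size vs)%:E.

Lemma measurable_offspring_event s k : measurable [set t | offspring_event s k t].
Proof.
elim: s => [|w s IH]; first by rewrite (_ : mkset _ = setT)//; apply/seteqP; split.
rewrite (_ : mkset _ = (N w @^-1` [set k w]) `&` [set t | offspring_event s k t]).
  by apply: measurableI => //; exact: measurable_funPTI.
by apply/seteqP; split=> t /=; [move=> /andP[/eqP -> ->]|move=> [-> ->]; rewrite eqxx].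
Qed.

Lemma measurable_all_event A vs :
  (forall v, measurable [set t | A v t]) -> measurable [set t | all_event A vs t].
Proof.
move=> mA; elim: vs => [|w s IH]; first by rewrite (_ : mkset _ = setT)//; apply/seteqP; split.
rewrite (_ : mkset _ = [set t | A w t] `&` [set t | all_event A s t]).
  exact: measurableI.
by apply/seteqP; split=> t /=; [move=> /andP[-> ->]|move=> [-> ->]].
Qed.

Lemma measurable_andb (a b : T -> bool) : measurable [set t | a t] ->
  measurable [set t | b t] -> measurable [set t | a t && b t].
Proof.
move=> ma mb; rewrite (_ : mkset _ = [set t | a t] `&` [set t | b t]); first exact: measurableI.
by apply/seteqP; split=> t /=; [move=> /andP[-> ->]|move=> [-> ->]].
Qed.

Lemma measurable_negb (a : T -> bool) : measurable [set t | a t] ->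
  measurable [set t | ~~ a t].
Proof.
move=> ma; rewrite (_ : mkset _ = ~` [set t | a t]); first exact: measurableC.
by apply/seteqP; split=> t /= /negP.
Qed.

Lemma probability_split (a b : T -> bool) : measurable [set t | a t] ->
  measurable [set t | b t] ->
  P [set t | a t] = (P [set t | a t && b t] + P [set t | a t && ~~ b t])%E.
Proof.
move=> ma mb; rewrite -measureU.
- congr (P _); apply/seteqP; split=> t /=.
    by move=> ->; case: (b t); [left|right].
  by case=> /andP[].
- exact: measurable_andb.
- by apply: measurable_andb => //; exact: measurable_negb.
- by apply/seteqP; split=> t //= [/andP[_ ->]]; rewrite andbF.
Qed.

(** P(X and not [A v]) = P(X) - P(X and [A v]), applied one node at a time. In the proof, [ws]
    gathers the nodes where [A] itself is required, so that both terms on the right fall under the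
    induction hypothesis. *)
Lemma level_indep_compl l A a :
  level_indep l A a -> level_indep l (fun v t => ~~ A v t) (1 - a).
Proof.
move=> [mA HA]; split=> [v|s k vs us ls uvs lvs]; first exact: measurable_negb.
suff gen ws : uniq (ws ++ vs) -> all (fun v => size v == l) (ws ++ vs) ->
    P [set t | (offspring_event s k t && all_event A ws t) &&
       all_event (fun v t => ~~ A v t) vs t] =
    ((\prod_(w <- s) p (k w)) * a ^+ size ws * (1 - a) ^+ size vs)%:E.
  have := gen [::] uvs lvs; rewrite expr0 mulr1 => <-.
  by congr (P _); apply/seteqP; split=> t /=; rewrite andbT.
elim: vs ws {uvs lvs} => [|v vs IH] ws.
  rewrite cats0 expr0 mulr1 => uws lws; rewrite -HA//.
  by congr (P _); apply/seteqP; split=> t /=; rewrite andbT.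
move=> uws lws.
have mX : measurable [set t | (offspring_event s k t && all_event A ws t) &&
       all_event (fun v t => ~~ A v t) vs t].
  apply: measurable_andb; [apply: measurable_andb|].
  - exact: measurable_offspring_event.
  - exact: measurable_all_event.
  - by apply: measurable_all_event => w; exact: measurable_negb.
have := probability_split mX (mA v).
have pws : perm_eq (ws ++ v :: vs) ((v :: ws) ++ vs) by rewrite (perm_catCA ws [:: v] vs).
move: uws lws; rewrite (perm_uniq pws) (perm_all _ pws) => uws lws.
rewrite [X in X = (_ + _)%E -> _]IH; last 2 first.
- by case/andP: uws.
- by case/andP: lws.
rewrite (_ : [set t | _ && A v t] = [set t |
    offspring_event s k t && all_event A (v :: ws) t &&
    all_event (fun v t => ~~ A v t) vs t]); last first.
  by apply/funext => t /=; congr is_true; rewrite andbAC -!andbA; do !bool_congr.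
rewrite IH// => E.
rewrite (_ : [set t | _] = [set t |
    offspring_event s k t && all_event A ws t &&
    all_event (fun v t => ~~ A v t) vs t && ~~ A v t]); last first.
  by apply/funext => t /=; congr is_true; rewrite -!andbA; do !bool_congr.
set x := P _ in E *.
have fx : x \is a fin_num.
  by apply/fin_num_measure/measurable_andb => //; exact: measurable_negb.
rewrite -(fineK fx) in E *; move: E; rewrite -EFinD => -[E]; congr EFin.
rewrite /= !exprS in E *; lra.
Qed.

(** Conditioning on the offspring number of a node [v]: given [j] children, [A v] has probability
    [b ^+ j], and summing against [p j] produces the generating function at [b]. *)
Lemma level_indep_step l A B (b : R) : 0 <= b <= 1 ->
  (forall v, measurable [set t | A v t]) ->
  (forall v t, size v = l -> (0 < N v t)%N ->
     A v t = all_event B [seq rcons v j | j <- iota 0 (N v t)] t) ->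
  (forall v (j : nat), distribution P (N v) [set j] = (p j)%:E) ->
  level_indep l.+1 B b -> level_indep l A (pgf p b).
Proof.
move=> b01 mA AB dN [mB HB]; split=> // s k vs us ls uvs lvs.
(* The induction on [vs] reveals one offspring number at a time: a treated node of level [l] is
   moved to [s], and its children join [ws], the nodes of level [l.+1] where [B] is required. The
   side conditions keep these lists free of repetitions. *)
suff gen ws : uniq s -> all (fun w => size w <= l)%N s ->
    ~~ has (mem s) vs ->
    uniq ws -> all (fun v => size v == l.+1) ws ->
    (forall v j, v \in vs -> rcons v j \notin ws) ->
    P [set t | (offspring_event s k t && all_event B ws t) && all_event A vs t] =
    ((\prod_(w <- s) p (k w)) * b ^+ size ws * (pgf p b) ^+ size vs)%:E.
  have -> : [set t | offspring_event s k t && all_event A vs t] = [set t |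
      (offspring_event s k t && all_event B [::] t) && all_event A vs t].
    by apply/funext => t /=; rewrite andbT.
  rewrite gen//= ?mulr1//.
    by apply: sub_all ls => w; exact: ltnW.
  apply/hasPn => v /(allP lvs) /eqP lv; apply/negP => /(allP ls) /=.
  by rewrite lv ltnn.
elim: vs uvs lvs s k ws {us ls} => [|v vs IH] /= uvs lvs s k ws us ls.
  move=> _ uws lws _; rewrite mulr1 -HB//.
  by congr (P _); apply/funext => t /=; rewrite andbT.
rewrite negb_or => /andP[vs_ svs] uws lws ws_.
have [/andP[vvs uvs'] /andP[/eqP lv lvs']] := (uvs, lvs).
pose E := [set t | (offspring_event s k t && all_event B ws t) &&
  (A v t && all_event A vs t)].
have mE : measurable E.
  apply: measurable_andb; [apply: measurable_andb|apply: measurable_andb => //].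
  - exact: measurable_offspring_event.
  - exact: measurable_all_event.
  - exact: measurable_all_event.
have mN j : measurable (N v @^-1` [set j]) by exact: measurable_funPTI.
rewrite -/E (_ : E = \bigcup_j (E `&` N v @^-1` [set j])); last first.
  by apply/seteqP; split=> [t Et|t [j _ []]//]; exists (N v t).
rewrite measure_semi_bigcup; last 3 first.
- by move=> j; exact: measurableI.
- apply/trivIsetP => i j _ _ ij; apply/seteqP; split=> // t /=.
  by move=> [[_ iE] [_ jE]]; move: ij; rewrite -iE -jE eqxx.
- by apply: bigcup_measurable => j _; exact: measurableI.
set c := \prod_(w <- s) p (k w).
transitivity (\sum_(0 <= j <oo)
    (c * b ^+ size ws * (pgf p b) ^+ size vs * (p j * b ^+ j))%:E)%E.
  apply: eq_eseriesr => j _.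
  (* [AB] only concerns nodes with at least one child; the childless case has probability
     [p 0 = 0]. *)
  case: j => [|j].
    have p0 : p 0%N = 0 by case: hp.
    rewrite p0 mul0r mulr0; apply/eqP; rewrite eq_le measure_ge0 andbT.
    have := dN v 0%N; rewrite p0 => <-; apply: le_measure; rewrite ?inE.
    - exact: measurableI.
    - exact: mN.
    - exact: subIsetr.
  pose k' w := if w == v then j.+1 else k w.
  pose ch := [seq rcons v i | i <- iota 0 j.+1].
  have kk' w : w \in s -> k' w = k w.
    by move=> ws0; rewrite /k'; case: eqP => // wv; rewrite -wv ws0 in vs_.
  have -> : E `&` N v @^-1` [set j.+1] = [set t |
      (offspring_event (v :: s) k' t && all_event B (ch ++ ws) t) &&
      all_event A vs t].
    have sE t : offspring_event s k' t = offspring_event s k t.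
      by apply: eq_in_all => w ws0; rewrite kk'.
    apply/seteqP; split=> t /=; rewrite sE {1}/k' eqxx all_event_cat.
      case=> /andP[/andP[-> ->]] /andP[Av ->] Nv.
      by rewrite Nv eqxx !andbT /=; move: Av; rewrite AB// ?Nv.
    case/andP => /andP[/andP[/eqP Nv os] /and3P[B0 Bc Bw]] Avs.
    by split=> //; rewrite /E /= os Bw Avs AB ?Nv//= B0 Bc.
  apply: etrans (IH uvs' lvs' (v :: s) k' (ch ++ ws) _ _ _ _ _ _) _.
  - by rewrite /= vs_.
  - by rewrite /= lv leqnn.
  - apply/hasPn => w wvs /=; rewrite inE negb_or (hasPn svs)// andbT.
    by apply: contraNneq vvs => <-.
  - rewrite cat_uniq uws andbT; apply/andP; split.
      by rewrite map_inj_uniq ?iota_uniq// => i i' /rcons_inj[].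
    apply/hasPn => w wws; apply/negP => /mapP[i _ wE].
    by move: wws; rewrite wE; apply/negP/ws_/mem_head.
  - rewrite all_cat lws andbT; apply/allP => w /mapP [i _ ->].
    by rewrite size_rcons lv.
  - move=> w i wvs; rewrite mem_cat negb_or ws_ ?andbT; last by rewrite inE wvs orbT.
    apply/negP => /mapP[i' _ /rcons_inj[wv _]].
    by move: vvs; rewrite -wv wvs.
  - rewrite big_cons {1}/k' eqxx.
    under eq_big_seq => w ws0 do rewrite kk'//.
    rewrite -/c size_cat size_map size_iota exprD; congr EFin; ring.
apply/cvg_lim => //.
under eq_fun do rewrite sumEFin -mulr_sumr.
apply: cvg_EFin; first by near=> n.
rewrite exprS [pgf p b * _]mulrC mulrA.
apply: cvgMl_tmp.
under eq_fun do rewrite big_mkord -horner_pgf_poly.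
exact: pgf_poly_cvg.
Unshelve. all: by end_near. Qed.

End tree.

(** * The unit interval and the uniform distribution function *)

Section pgf_range.
Context {R : realType}.
Variable p : nat -> R.
Hypothesis hp : offspring_pmf p.

Lemma pgf_ge0 x : 0 <= x <= 1 -> 0 <= pgf p x.
Proof.
move=> x01; have x0 : 0 <= x by case/andP: x01.
rewrite -(cvg_lim _ (pgf_poly_cvg hp x01))//.
apply: limr_ge; first exact: cvgP (pgf_poly_cvg hp x01).
near=> n; rewrite horner_pgf_poly; apply: sumr_ge0 => i _.
by rewrite mulr_ge0 ?exprn_ge0//; case: hp.
Unshelve. all: by end_near. Qed.

Lemma pgf_le1 x : 0 <= x <= 1 -> pgf p x <= 1.
Proof.
move=> x01.
rewrite -(cvg_lim _ (pgf_poly_cvg hp x01))//.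
apply: limr_le; first exact: cvgP (pgf_poly_cvg hp x01).
near=> n; exact: le_trans (pgf_poly_le hp n x01) (pgf_poly1_le1 hp n).
Unshelve. all: by end_near. Qed.

Lemma pgf_compl_itv x : 0 <= x <= 1 -> 0 <= pgf_compl p x <= 1.
Proof. by move=> x01; rewrite subr_ge0 gerBl pgf_ge0// pgf_le1. Qed.

Lemma pgf_iter_itv x : 0 <= x <= 1 -> 0 <= pgf_iter p x <= 1.
Proof. by move=> x01; rewrite !pgf_compl_itv. Qed.

End pgf_range.

(** This is the distribution function of U[0, 1]. It is also used to extend to the whole line
    functions that only make sense on [0, 1]. *)
Definition clamp01 {R : realType} (x : R) : R := Num.min (Num.max x 0) 1.

Section clamp.
Context {R : realType}.
Implicit Type x : R.

Lemma clamp01_itv x : 0 <= clamp01 x <= 1.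
Proof. by rewrite /clamp01 ge_min lexx orbT le_min le_max lexx orbT ler01. Qed.

Lemma clamp01_id x : 0 <= x <= 1 -> clamp01 x = x.
Proof. by case/andP => x0 x1; rewrite /clamp01 max_l// min_l. Qed.

Lemma clamp01_le0 x : x <= 0 -> clamp01 x = 0.
Proof. by move=> x0; rewrite /clamp01 max_r// min_l. Qed.

Lemma clamp01_ge1 x : 1 <= x -> clamp01 x = 1.
Proof. by move=> x0; rewrite /clamp01 min_r// le_max x0. Qed.

Lemma clamp01_homo x y : x <= y -> clamp01 x <= clamp01 y.
Proof.
move=> xy; rewrite /clamp01 le_min !ge_min lexx orbT andbT.
by rewrite ge_max !le_max xy lexx orbT.
Qed.

Lemma uniform_prob_itvNy x :
  uniform_prob (@ltr01 R) `]-oo, x]%classic = (clamp01 x)%:E.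
Proof.
rewrite /uniform_prob integral_uniform_pdf.
have -> : `]-oo, x] `&` `[0, 1] = `[0, Num.min x 1]%classic :> set R.
  apply/seteqP; split=> y /=; rewrite !in_itv/= le_min.
    by case=> -> /andP[-> ->].
  by case/and3P=> -> -> ->.
rewrite (eq_integral (cst 1%E)); last first.
  move=> y; rewrite inE/= in_itv/= le_min => /and3P[y0 _ y1].
  by rewrite /uniform_pdf y0 y1 subr0 invr1.
rewrite integral_cst//= mul1e lebesgue_measure_itv/= lte_fin.
rewrite /clamp01; case: ltP => [|x0].
  by rewrite lt_min => /andP[x0 _]; rewrite sube0 max_l// ltW.
rewrite max_r ?min_l//; move: x0.
by rewrite ge_min [1 <= 0]leNgt ltr01 orbF.
Qed.

End clamp.

(** * The distribution function of W_2n *)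

Section minimax_cdf.
Context {R : realType} {d : measure_display} {T : measurableType d}.
Context {P : probability T R}.
Variables (N : seq nat -> {RV P >-> nat}) (U : seq nat -> {RV P >-> R}).
Variable p : nat -> R.
Hypotheses (hp : offspring_pmf p) (hNU : minimax_data N U p).

(** Base of the recursion, read off from [minimax_data]: the finite index set [J] holds the nodes of
    [s] on the offspring side and those of [vs] on the label side. *)
Lemma level_indep_leaves n x :
  level_indep N p n.*2 (fun v t => U v t <= x) (clamp01 x).
Proof.
case: hNU => dN uU hI; split=> [v|s k vs us ls uvs lvs].
  rewrite (_ : mkset _ = U v @^-1` `]-oo, x]); first exact: measurable_funPTI.
  by apply/seteqP; split=> t /=; rewrite in_itv.
pose J := (map inl s ++ map inr vs : seq (seq nat + seq nat)).
have uJ : uniq J.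
  rewrite cat_uniq !map_inj_uniq ?us ?uvs; try by move=> ? ? [].
  by rewrite andbT; apply/hasPn => _ /mapP[w _ ->]; apply/negP => /mapP[].
pose E (i : seq nat + seq nat) : set T := match i with
  | inl w => N w @^-1` [set k w]
  | inr v => U v @^-1` `]-oo, x] end.
have JE : perm_eq [fset i in J]%fset J.
  apply: uniq_perm => //. by move=> i; rewrite in_fset.
have := hI n [fset i in J]%fset _ E.
rewrite (perm_big _ JE) big_cat/= !big_map.
have -> : (\prod_(w <- s) P (E (inl w)) = (\prod_(w <- s) p (k w))%:E)%E.
  by rewrite -prodEFin; apply: eq_bigr => w _; rewrite -(dN w (k w)).
have -> : (\prod_(w <- vs) P (E (inr w)) = (clamp01 x ^+ size vs)%:E)%E.
  transitivity (\prod_(w <- vs) (clamp01 x)%:E)%E.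
    apply: eq_bigr => w _; rewrite -uniform_prob_itvNy -(uU w)//.
  by rewrite prodEFin big_const_seq count_predT iter_mulr_1.
rewrite -EFinM => <-.
- congr (P _); apply/seteqP; split=> t /=.
    move=> /andP[/allP Hs /allP Hvs] i /=; rewrite in_fset /J mem_cat.
    move=> /orP[] /mapP[w ws ->] /=; [exact/eqP/Hs|].

    by rewrite in_itv/= Hvs.
  move=> H; apply/andP; split; apply/allP => w ws.
    by apply/eqP; apply: (H (inl w)); rewrite /= in_fset /J mem_cat map_f.
  have := H (inr w); rewrite /= in_itv/=; apply.
  by rewrite in_fset /J mem_cat map_f ?orbT.
- move=> i /=; rewrite in_fset /J mem_cat => /orP[] /mapP[w ws ->]; [by left; exists w|right].
  by exists w => //=; apply/eqP/(allP lvs).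
- move=> [w|w] _ /=.
    by exists [set k w] => //; rewrite setTI.
  by exists `]-oo, x]%classic => //; rewrite setTI.
Qed.

Let val h v t := minimax_value (fun v => N v t) (fun v => U v t) h v.

Lemma measurable_minimax_value h v : measurable_fun setT (val h v).
Proof.
elim: h v => [|h IH] v /=; first exact: measurable_funPT.
rewrite /val/=; case: (odd (size v)).
- by apply: (@measurable_bigop_random_ord _ _ _ P Num.max (N v)
    (fun j => val h (rcons v j))) => [f g|j];
    [exact: measurable_maxr|exact: IH].
- by apply: (@measurable_bigop_random_ord _ _ _ P Num.min (N v)
    (fun j => val h (rcons v j))) => [f g|j];
    [exact: measurable_minr|exact: IH].
Qed.

Lemma measurable_minimax_value_le h v x : measurable [set t | val h v t <= x].
Proof.
rewrite (_ : mkset _ = val h v @^-1` `]-oo, x]).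
  by rewrite -[X in measurable X]setTI; apply: measurable_minimax_value.
by apply/seteqP; split=> t /=; rewrite in_itv.
Qed.

(** A maximum is at most [x] iff all children are, which gives G; a minimum exceeds [x] iff all
    children do, which gives G again, between two complements. Together these make f. *)
Lemma level_indep_minimax_value l h x a : ~~ odd l -> 0 <= a <= 1 ->
  level_indep N p l.+2 (fun v t => val h v t <= x) a ->
  level_indep N p l (fun v t => val h.+2 v t <= x) (pgf_iter p a).
Proof.
case: hNU => dN _ _ ol a01 H.
have H1 : level_indep N p l.+1 (fun v t => val h.+1 v t <= x) (pgf p a).
  apply: level_indep_step H => // [v|v t lv Nv]; first exact: measurable_minimax_value_le.
  rewrite /val /all_event /= lv /= ol all_map; apply/bigmax_leP/allP => /=.
    by move=> [_ H] j; rewrite mem_iota add0n => /= jN; apply: (H (Ordinal jN)).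
  (* The first goal concerns the initial value of the iterated maximum; it is the value of the first
     child, which exists by [Nv]. *)
  move=> H; split=> [|i _]; apply: H; by rewrite mem_iota add0n ?Nv ?ltn_ord.
have H2 : level_indep N p l (fun v t => ~~ (val h.+2 v t <= x)) (pgf p (pgf_compl p a)).
  apply: level_indep_step (level_indep_compl H1) => // [|v|v t lv Nv].
  - exact: pgf_compl_itv.
  - exact/measurable_negb/measurable_minimax_value_le.
  rewrite /val /all_event /= lv (negbTE ol) all_map -ltNge; apply/bigmin_gtP/allP => /=.
    move=> [_ H'] j; rewrite mem_iota add0n => /= jN; rewrite -ltNge.
    exact: (H' (Ordinal jN)).
  move=> H'; split=> [|i _]; rewrite ltNge; apply: H'; by rewrite mem_iota add0n ?Nv ?ltn_ord.
have := level_indep_compl H2.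
by under [X in level_indep _ _ _ X]eq_fun do under eq_fun do rewrite negbK.
Qed.

Lemma cdf_minimax n x :
  cdf (minimax N U n : {RV P >-> R}) x = (iter n (pgf_iter p) (clamp01 x))%:E.
Proof.
have iter01 m : 0 <= iter m (pgf_iter p) (clamp01 x) <= 1.
  by elim: m => [|m IH]; [exact: clamp01_itv|exact: pgf_iter_itv].
(* Induction from the leaves upwards, two levels at a time: a subtree of height [m.*2] is rooted at
   level [(n - m).*2]. *)
have H m : (m <= n)%N -> level_indep N p (n - m).*2
    (fun v t => val m.*2 v t <= x) (iter m (pgf_iter p) (clamp01 x)).
  elim: m => [_|m IH mn]; first by rewrite subn0; exact: level_indep_leaves.
  apply: (@level_indep_minimax_value _ m.*2); [by rewrite odd_double|exact: iter01|].
  by rewrite -doubleS subnSK//; apply: IH; exact: ltnW.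
(* At level 0, with no constraint on offspring numbers and the root as only node, the product
   formula is the distribution function. *)
have [_ /(_ [::] (fun=> 0%N) [:: [::]])] := H n (leqnn n).
rewrite subnn => /(_ isT isT isT isT); rewrite big_nil mul1r expr1 => <-.
congr (P _); apply/seteqP; split=> t /=; rewrite in_itv/= andbT//.
Qed.

End minimax_cdf.

(** * Pointwise limits of polynomials with geometrically bounded coefficients *)

Section poly_tail.
Context {R : realType}.
Implicit Types (P : {poly R}) (r M x : R).

Lemma geometric_sum_le2 (t : R) n : 0 <= t <= 1 / 2 -> \sum_(i < n) t ^+ i <= 2.
Proof.
move=> /andP[t0 t12].
suff : \sum_(i < n) t ^+ i <= 2 - 2 * t ^+ n.
  by move/le_trans; apply; rewrite gerBl mulr_ge0// exprn_ge0.
elim: n => [|n IH]; first by rewrite big_ord0 expr0; lra.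
rewrite big_ord_recr/= exprS.
have := exprn_ge0 n t0; nra.
Qed.

(** The tail is dominated by a geometric series of ratio at most 1/2, whence the factor 2. The bound
    does not depend on the degree of [P], so it survives a limit of polynomials. *)
Lemma poly_tail_le P r M x k : 0 < r -> (forall i, `|P`_i| * r ^+ i <= M) ->
  `|x| <= r / 2 ->
  `|P.[x] - \sum_(i < k) P`_i * x ^+ i| <= 2 * M * (`|x| / r) ^+ k.
Proof.
move=> r0 PM xr.
have t01 : 0 <= `|x| / r <= 1 / 2.
  by rewrite divr_ge0 ?(ltW r0)//= ler_pdivrMr// mulrC mulrA mulr1.
(* Padding the sum to [k + size P] terms makes the cut at [k] possible even beyond the degree. *)
rewrite (horner_coef_wide _ (leq_addl k (size P))).
rewrite -!(big_mkord xpredT (fun i => P`_i * x ^+ i)).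
rewrite (big_cat_nat _ (leq_addr (size P) k))//= [X in X - _]addrC addrK.
rewrite -{1}[k]add0n big_addn addnC addnK big_mkord.
apply: (le_trans (ler_norm_sum _ _ _)).
apply: (@le_trans _ _ (\sum_(i < size P) M * (`|x| / r) ^+ k * (`|x| / r) ^+ i)).
  apply: ler_sum => i _; rewrite -mulrA -exprD normrM normrX expr_div_n mulrA.
  rewrite ler_pdivlMr ?exprn_gt0// addnC mulrAC ler_wpM2r ?exprn_ge0//; exact: PM.
rewrite -mulr_sumr mulrAC ler_wpM2r ?exprn_ge0 ?divr_ge0// ?(ltW r0)//.
rewrite mulrC ler_wpM2r ?geometric_sum_le2//.
by apply: le_trans (PM 0%N); rewrite mulr_ge0// exprn_ge0// ltW.
Qed.

Lemma ultra_fmap (A B : Type) (u : A -> B) (F : set_system A) :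
  UltraFilter F -> UltraFilter (u @ F).
Proof.
move=> FU; split; first exact: fmap_proper_filter.
move=> G GP FG; apply/seteqP; split=> // X GX.
case: (in_ultra_setVsetC (u @^-1` X) FU) => // FX.
have GnX : G (~` X) by apply: FG; rewrite /= preimage_setC.
by have [b []] := filter_ex (@filterI _ _ _ _ _ GX GnX).
Qed.

(** Compactness of the segment. Since one ultrafilter serves all bounded sequences, the coefficients
    of every order converge together, with no diagonal extraction. *)
Lemma ultra_bounded_cvg (F : set_system nat) (u : nat -> R) M :
  UltraFilter F -> (forall n, `|u n| <= M) -> exists l : R, u @ F --> l.
Proof.
move=> FU uM.
have := @segment_compact R (- M) M; rewrite compact_ultra => /(_ (u @ F) _)[].
- exact: ultra_fmap.
- by apply: (@filterE _ F) => n /=; rewrite in_itv/= -ler_norml; exact: uM.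
- by move=> l [_ ul]; exists l.
Qed.

(** An identity theorem that avoids derivatives of [h]: the limits [c i] of the coefficients play
    the role of its Taylor coefficients at 0. *)
Lemma poly_limit_isolated_zero (h : R -> R) (P : nat -> {poly R}) r M :
  0 < r -> (forall n i, `|(P n)`_i| * r ^+ i <= M) ->
  (forall x, `|x| <= r / 2 -> (P n).[x] @[n --> \oo] --> h x) ->
  exists2 e, 0 < e &
    (forall x, `|x| < e -> h x = 0) \/ (forall x, 0 < `|x| < e -> h x != 0).
Proof.
move=> r0 PM Ph.
have [F [FU ooF]] := ultraFilterLemma eventually_filter.
have FF : ProperFilter F by exact: _.
have M0 : 0 <= M by apply: le_trans (PM 0%N 0%N); rewrite mulr_ge0.
have /choice[c cP] : forall i, exists l : R, (P n)`_i @[n --> F] --> l.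
  move=> i; apply: (@ultra_bounded_cvg _ _ (M / r ^+ i)) => n.
  by rewrite ler_pdivlMr ?exprn_gt0.
have {}Ph x : `|x| <= r / 2 -> (P n).[x] @[n --> F] --> h x.
  by move=> xr; apply: cvg_trans (Ph x xr); exact: (cvg_app (fun n => (P n).[x]) ooF).
(* Limit of [poly_tail_le] along [F]: once the coefficients below [m] vanish, [h x] is
   [c m * x ^+ m] up to an error of order [m.+1]. *)
have key m x : `|x| <= r / 2 -> (forall i, (i < m)%N -> c i = 0) ->
    `|h x - c m * x ^+ m| <= 2 * M * (`|x| / r) ^+ m.+1.
  move=> xr c0.
  have : (P n).[x] - \sum_(i < m.+1) (P n)`_i * x ^+ i @[n --> F] -->
      h x - \sum_(i < m.+1) c i * x ^+ i.
    apply: cvgB; first exact: Ph.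
    apply: cvg_big => [|i _]; [exact: add_continuous|exact: cvgMr_tmp (cP i)].
  rewrite big_ord_recr/= big1 ?add0r => [|i _]; last by rewrite c0 ?mul0r.
  move=> /cvg_norm H.
  apply: (closed_cvg [set y | y <= 2 * M * (`|x| / r) ^+ m.+1] _ _ _ H).
    exact: closed_le.
  by apply: filterE => n /=; exact: poly_tail_le.
have [/forallNP c0|/contrapT cex] := pselect (~ exists m, c m != 0).
  exists (r / 2); first by rewrite divr_gt0.
  left => x /ltW xr.
  have {}c0 i : c i = 0 by have /negP := c0 i; rewrite negbK => /eqP.
  (* With all [c i] zero, [key] holds at every order, and its bound tends to 0. *)
  have H m : `|h x| <= M * (1 / 2) ^+ m.
    have -> : M * (1 / 2) ^+ m = 2 * M * (1 / 2) ^+ m.+1 by rewrite exprS; field.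
    have := key m x xr (fun i _ => c0 i); rewrite c0 mul0r subr0.
    move=> /le_trans; apply; rewrite ler_wpM2l ?mulr_ge0//.
    rewrite lerXn2r ?nnegrE ?divr_ge0// ?(ltW r0)//.
    by rewrite ler_pdivrMr// mulrC mulrA mulr1.
  apply/eqP; rewrite -normr_le0.
  have : M * (1 / 2) ^+ m @[m --> \oo] --> M * (0 : R).
    by apply: cvgMl_tmp; apply: cvg_expr; rewrite ger0_norm//; lra.
  rewrite mulr0 => H0; have : closed [set y | `|h x| <= y] by exact: closed_ge.
  by move=> /closed_cvg /(_ _ _ H0); apply; apply: filterE => m; exact: H.
have := ex_minnP cex => -[m cm mmin].
have c0 i : (i < m)%N -> c i = 0.
  by move=> im; apply/eqP; apply: contraTT im => /mmin; rewrite -leqNgt.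
have cm0 : 0 < `|c m| by rewrite normr_gt0.
(* Chosen so that the leading term beats the error, that is [2 * M * |x| < |c m| * r ^+ m.+1]; the
   added 1 keeps the denominator positive when [M = 0]. *)
pose e := Num.min (r / 2) (`|c m| * r ^+ m.+1 / (2 * M + 1)).
exists e; first by rewrite lt_min !divr_gt0// ?mulr_gt0 ?exprn_gt0//; lra.
right => x /andP[x0]; rewrite lt_min => /andP[/ltW xr xe].
apply/negP => /eqP hx0; have := key m x xr c0.
rewrite hx0 sub0r normrN normrM normrX expr_div_n leNgt => /negP; apply.
rewrite mulrA ltr_pdivrMr ?exprn_gt0// (exprS `|x|).
have {}xe : 2 * M * `|x| < `|c m| * r ^+ m.+1.
  by move: xe; rewrite ltr_pdivlMr; [nra|lra].
by move: xe; rewrite -(ltr_pM2r (exprn_gt0 m x0)); lra.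
Qed.

End poly_tail.

(** * Coefficientwise majorants of polynomials *)

Section majorant.
Context {R : realType}.
Implicit Types P Q A B G : {poly R}.

Definition majorized P Q := forall i, `|P`_i| <= Q`_i.

Lemma majorizedD P Q A B : majorized P A -> majorized Q B -> majorized (P + Q) (A + B).
Proof.
by move=> PA QB i; rewrite !coefD (le_trans (ler_normD _ _))// lerD.
Qed.

Lemma majorizedN P A : majorized P A -> majorized (- P) A.
Proof. by move=> PA i; rewrite coefN normrN. Qed.

Lemma majorizedM P Q A B : majorized P A -> majorized Q B -> majorized (P * Q) (A * B).
Proof.
move=> PA QB i; rewrite !coefM (le_trans (ler_norm_sum _ _ _))//.
by apply: ler_sum => j _; rewrite normrM ler_pM.
Qed.

Lemma majorizedC (c : R) : majorized c%:P `|c|%:P.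
Proof. by move=> i; rewrite !coefC; case: ifP => //; rewrite normr0. Qed.

Lemma majorizedX : majorized 'X 'X.
Proof. by move=> i; rewrite coefX ger0_norm// ler0n. Qed.

Lemma majorized_comp P Q B : (forall i, 0 <= P`_i) -> majorized Q B ->
  majorized (P \Po Q) (P \Po B).
Proof.
elim/poly_ind: P => [|P c IH] Pc QB.
  by rewrite !comp_poly0 => i; rewrite coef0 normr0.
rewrite !comp_polyD !comp_polyM !comp_polyX !comp_polyC.
apply: majorizedD; last first.
  have := Pc 0%N; rewrite coefD coefMX coefC/= add0r => c0.
  by rewrite -{2}(ger0_norm c0); exact: majorizedC.
apply: majorizedM => //; apply: IH => // i.
by have := Pc i.+1; rewrite coefD coefMX coefC/= addr0.
Qed.

(** A Cauchy-type estimate: the terms of [Q.[r]] are nonnegative, so each of them is at most their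
    sum. *)
Lemma majorized_coef_le P Q r i : 0 <= r -> majorized P Q -> `|P`_i| * r ^+ i <= Q.[r].
Proof.
move=> r0 PQ; have Q0 j : 0 <= Q`_j by exact: le_trans (PQ j).
have := PQ i; have [iQ|iQ] := ltnP i (size Q); last first.
  rewrite (nth_default _ iQ) => /(conj (normr_ge0 _)) /andP/le_anti <-.
  by rewrite mul0r horner_coef; apply: sumr_ge0 => j _; rewrite mulr_ge0 ?exprn_ge0.
move=> Pi; rewrite horner_coef (bigD1 (Ordinal iQ))//=.
rewrite -[leLHS]addr0 lerD//; first by rewrite ler_wpM2r ?exprn_ge0.
by apply: sumr_ge0 => j _; rewrite mulr_ge0 ?exprn_ge0.
Qed.

End majorant.

(** * Uniform approximation, continuity and positivity of the generating function *)

Section pgf_continuous.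
Context {R : realType}.
Variable p : nat -> R.
Hypothesis hp : offspring_pmf p.
Local Notation G := (pgf p).

Lemma pgf0 : G 0 = 0.
Proof.
have x01 : 0 <= (0 : R) <= 1 by rewrite lexx ler01.
apply: (cvg_unique _ (pgf_poly_cvg hp x01)) => //.
apply: cvg_near_cst; apply: nearW => n.
rewrite horner_pgf_poly; case: n => [|n]; first by rewrite big_ord0.
rewrite big_ord_recl/= big1 ?addr0 => [|i _]; last by rewrite expr0n/= mulr0.
by case: hp => -> _ _; rewrite mul0r.
Qed.

Lemma pgf1 : G 1 = 1.
Proof.
have x01 : 0 <= (1 : R) <= 1 by rewrite lexx ler01.
exact: (cvg_unique _ (pgf_poly_cvg hp x01) (pgf_poly1_cvg hp)).
Qed.

Lemma pgf_le x y : 0 <= x -> x <= y -> y <= 1 -> G x <= G y.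
Proof.
move=> x0 xy y1.
have x01 : 0 <= x <= 1 by rewrite x0 (le_trans xy).
have y01 : 0 <= y <= 1 by rewrite y1 (le_trans x0).
apply: ler_cvg_to (pgf_poly_cvg hp x01) (pgf_poly_cvg hp y01) _.
by apply: nearW => n; apply: pgf_poly_le; rewrite // x0.
Qed.

(** Termwise, the tail of the series at [x] is at most the tail at 1; the approximation is thus
    uniform on [0, 1]. *)
Lemma pgf_poly_approx n x : 0 <= x <= 1 ->
  `|G x - (pgf_poly p n).[x]| <= 1 - (pgf_poly p n).[1].
Proof.
move=> /andP[x0 x1].
have x01 : 0 <= x <= 1 by rewrite x0.
rewrite ger0_norm.
  apply: (@ler_cvg_to _ \oo _ _ (fun m => (pgf_poly p m).[x] - (pgf_poly p n).[x])
    (fun m => (pgf_poly p m).[1] - (pgf_poly p n).[1])).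
  - by apply: cvgB; [exact: pgf_poly_cvg|exact: cvg_cst].
  - by apply: cvgB; [exact: pgf_poly1_cvg|exact: cvg_cst].
  - near=> m; have nm : (n <= m)%N by near: m; exact: nbhs_infty_ge.
    rewrite !horner_pgf_poly.
    rewrite -!(big_mkord xpredT (fun i => p i * x ^+ i)).
    rewrite -!(big_mkord xpredT (fun i => p i * 1 ^+ i)).
    have sumB F : \sum_(0 <= i < m) F i - \sum_(0 <= i < n) F i = \sum_(n <= i < m) F i :> R.
      by rewrite (big_cat_nat (leq0n n) nm)/= addrAC subrr add0r.
    rewrite !sumB.
    apply: ler_sum => i _; rewrite ler_wpM2l ?lerXn2r ?nnegrE//.
    by case: hp.
rewrite subr_ge0 -(cvg_lim _ (pgf_poly_cvg hp x01))//.
apply: (@nondecreasing_cvgn_le _ (fun m => (pgf_poly p m).[x])).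
  by move=> a b ab; exact: pgf_poly_homo.
exact: cvgP (pgf_poly_cvg hp x01).
Unshelve. all: by end_near. Qed.

Lemma continuous_clamp01 : continuous (@clamp01 R).
Proof.
move=> x.
apply: (@continuous_min _ _ (fun y : R => Num.max y 0) (cst (1 : R))).
  apply: (@continuous_max _ _ (@idfun R) (cst (0 : R))); first exact: cvg_id.
  exact: cst_continuous.
exact: cst_continuous.
Qed.

Lemma continuous_pgf_clamp : continuous (fun x => G (clamp01 x)).
Proof.
move=> x; apply/cvgrPdist_lt => e e0.
have [n nP] : exists n, 1 - (pgf_poly p n).[1] < e / 3.
  have /cvgrPdist_lt/(_ (e / 3)) [|n _ nP] := pgf_poly1_cvg hp; first by rewrite divr_gt0.
  by exists n; have := nP n (leqnn n) => /=; exact: le_lt_trans (ler_norm _).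
have : (pgf_poly p n).[clamp01 y] @[y --> x] --> (pgf_poly p n).[clamp01 x].
  by apply: continuous_comp; [exact: continuous_clamp01|exact: continuous_horner].
move=> /cvgrPdist_lt/(_ (e / 3)); rewrite divr_gt0// => /(_ isT) H.
near=> y.
have Hy : `|(pgf_poly p n).[clamp01 x] - (pgf_poly p n).[clamp01 y]| < e / 3.
  by near: y.
have Hx2 := pgf_poly_approx n (clamp01_itv x).
have Hy2 := pgf_poly_approx n (clamp01_itv y).
move: nP Hy Hx2 Hy2; rewrite !ltr_norml !ler_norml; lra.
Unshelve. all: by end_near. Qed.

Lemma pgf_gt0 x : 0 < x <= 1 -> 0 < G x.
Proof.
move=> /andP[x0 x1].
have [n nP] : exists n, 0 < (pgf_poly p n).[1].
  have /cvgrPdist_lt/(_ 1) [|n _ nP] := pgf_poly1_cvg hp; first by [].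
  by exists n; have := nP n (leqnn n) => /=; rewrite ltr_norml; lra.
have x01 : 0 <= x <= 1 by rewrite ltW.
apply: (@lt_le_trans _ _ (pgf_poly p n).[x]).
  have /lt0r_neq0 := nP; rewrite !horner_pgf_poly => H.
  have pge k : 0 <= p k by case: hp.
  rewrite lt_neqAle sumr_ge0 ?andbT => [|i _]; last by rewrite mulr_ge0 ?exprn_ge0// ltW.
  rewrite eq_sym psumr_neq0 => [|i _]; last by rewrite mulr_ge0 ?exprn_ge0// ltW.
  move: H; rewrite psumr_neq0 => [|i _]; last by rewrite mulr_ge0 ?exprn_ge0.
  move=> /hasP[i iI]; rewrite expr1n mulr1 => /= pi0.
  by apply/hasP; exists i => //=; rewrite mulr_gt0// exprn_gt0.
rewrite -(cvg_lim _ (pgf_poly_cvg hp x01))//.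
apply: (@nondecreasing_cvgn_le _ (fun m => (pgf_poly p m).[x])).
  by move=> a b ab; apply: pgf_poly_homo => //; exact: ltW.
exact: cvgP (pgf_poly_cvg hp x01).
Qed.

End pgf_continuous.

(** * Fixed points of f *)

Section fixpoints.
Context {R : realType}.
Variable p : nat -> R.
Hypothesis hp : offspring_pmf p.
Local Notation G := (pgf p).
Local Notation f := (pgf_iter p).

Lemma pgf_poly_itv n x : 0 <= x <= 1 -> 0 <= (pgf_poly p n).[x] <= 1.
Proof.
move=> x01; rewrite (le_trans (pgf_poly_le hp n x01) (pgf_poly1_le1 hp n)) andbT.
have -> : 0 = (pgf_poly p 0).[x] by rewrite horner_pgf_poly big_ord0.
by apply: (pgf_poly_homo hp) => //; case/andP: x01.
Qed.

(** The index [n] occurs both in the outer polynomial and in its argument, so pointwise convergence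
    is not enough: [pgf_poly_approx] controls the outer change uniformly, continuity of G the inner
    one. *)
Lemma pgf_poly_iter_cvg y : 0 <= y <= 1 ->
  1 - (pgf_poly p n).[1 - (pgf_poly p n).[y]] @[n --> \oo] --> f y.
Proof.
move=> y01; apply: cvgB; first exact: cvg_cst.
have z01 n : 0 <= 1 - (pgf_poly p n).[y] <= 1.
  by have := pgf_poly_itv n y01; lra.
have H1 : G (clamp01 (1 - (pgf_poly p n).[y])) @[n --> \oo] --> G (pgf_compl p y).
  rewrite -(clamp01_id (pgf_compl_itv hp y01)).
  apply: (@cvg_comp _ _ _ (fun n => 1 - (pgf_poly p n).[y]) (fun z => G (clamp01 z)) \oo
    (nbhs (pgf_compl p y))); last exact: continuous_pgf_clamp.
  by apply: cvgB; [exact: cvg_cst|exact: pgf_poly_cvg].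
have H2 : 1 - (pgf_poly p n).[1] @[n --> \oo] --> (0 : R).
  by rewrite -(subrr 1); apply: cvgB; [exact: cvg_cst|exact: pgf_poly1_cvg].
apply/cvgrPdist_lt => e e0.
move/cvgrPdist_lt : H1 => /(_ (e / 2)); rewrite divr_gt0// => /(_ isT) H1.
move/cvgrPdist_lt : H2 => /(_ (e / 2)); rewrite divr_gt0// => /(_ isT) H2.
near=> n.
have /= K1 : `|G (pgf_compl p y) - G (clamp01 (1 - (pgf_poly p n).[y]))| < e / 2 by near: n.
have /= K2 : `|0 - (1 - (pgf_poly p n).[1])| < e / 2 by near: n.
have := pgf_poly_approx hp n (z01 n); move: K1 K2; rewrite clamp01_id//.
rewrite !ltr_norml !ler_norml; lra.
Unshelve. all: by end_near. Qed.

(** Continuity of G at [a], where G is positive. The factor 2 is what makes the majorant 1 - 2 G(a)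
    + G(a + r) at most 1; the other bounds on [r] keep [a - r, a + r] inside [0, 1]. *)
Lemma pgf_lt_double a : 0 < a < 1 ->
  exists r, [/\ 0 < r, r <= a, a + r <= 1 & G (a + r) < 2 * G a].
Proof.
move=> /andP[a0 a1].
have a01 : 0 <= a <= 1 by rewrite !ltW.
have Ga0 : 0 < G a by apply: (pgf_gt0 hp); rewrite a0 ltW.
have /cvgrPdist_lt/(_ _ Ga0)[e /= e0 He] := @continuous_pgf_clamp _ _ hp a.
pose r := Num.min (e / 2) (Num.min a (1 - a)).
have re : r <= e / 2 by rewrite ge_min lexx.
have ra : r <= a by rewrite !ge_min lexx orbT.
have r1a : r <= 1 - a by rewrite !ge_min lexx !orbT.
have r0 : 0 < r by rewrite !lt_min divr_gt0// a0 subr_gt0.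
exists r; split => //; first by lra.
have := He (a + r); rewrite /= opprD addrA subrr sub0r normrN gtr0_norm//.
rewrite !clamp01_id//; last by lra.
have -> : r < e by lra.
by move=> /(_ isT); rewrite ltr_norml; lra.
Qed.

Lemma pgf_poly_coef_ge0 n i : 0 <= (pgf_poly p n)`_i.
Proof. by rewrite coef_poly; case: ifP => // _; case: hp. Qed.

(* The coefficients of G_n(a + X) are nonnegative, so 1 - G_n(a + X) is majorized by
   1 - 2 G_n(a) + G_n(a + X), whose value at r is at most 1. *)
Lemma pgf_poly_iter_coef_bound n a r i : 0 <= a -> 0 <= r -> a + r <= 1 ->
  (pgf_poly p n).[a + r] <= 2 * (pgf_poly p n).[a] ->
  `|(1 - (pgf_poly p n \Po (1 - (pgf_poly p n \Po ('X + a%:P)))) - ('X + a%:P))`_i|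
    * r ^+ i <= 3.
Proof.
move=> a0 r0 ar1 H; set g := pgf_poly p n; set K := g \Po ('X + a%:P).
have mXa : majorized ('X + a%:P) ('X + a%:P).
  apply: majorizedD; first exact: majorizedX.
  by rewrite -{2}(ger0_norm a0); exact: majorizedC.
have mK : majorized K K by apply: majorized_comp mXa; exact: pgf_poly_coef_ge0.
have a01 : 0 <= a <= 1 by lra.
have ar01 : 0 <= a + r <= 1 by lra.
have K0 : K`_0 = g.[a].
  by rewrite -horner_coef0 /K horner_comp hornerD hornerX hornerC add0r.
have ga := pgf_poly_itv n a01.
pose B := (1 - 2 * g.[a])%:P + K.
have mQ : majorized (1 - K) B.
  move=> j; rewrite /B coefB coefD coef1 coefC; case: eqP => [->|_].
    by rewrite K0 ger0_norm/=; move: ga; rewrite -/g; lra.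
  by rewrite sub0r normrN add0r.
(* The constant 3 bounds the value of the majorant at [r]: 1 for the constant term, at most 1 for
   [g] at [B.[r]], and at most 1 for [r + a]. *)
have := majorized_coef_le i r0 (majorizedD (majorizedD (majorizedC 1)
  (majorizedN (majorized_comp (pgf_poly_coef_ge0 n) mQ))) (majorizedN mXa)).
rewrite polyC1 => /le_trans; apply.
rewrite !hornerD !hornerC !hornerX horner_comp normr1.
have B01 : 0 <= B.[r] <= 1.
  rewrite /B hornerD hornerC horner_comp hornerD hornerX hornerC [r + a]addrC.
  have := @pgf_poly_le _ _ hp n a (a + r); rewrite a0 lerDl r0 => /(_ isT).
  by move: ga H; rewrite -/g; lra.
by have := pgf_poly_itv n B01; rewrite -/g; lra.
Qed.

Lemma pgf_iter_fixpoint_dichotomy a : 0 < a < 1 ->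
  exists2 e, 0 < e & (forall x, `|x - a| < e -> f x = x) \/
                     (forall x, 0 < `|x - a| < e -> f x != x).
Proof.
move=> a01'; have [r [r0 ra ar1 Gr]] := pgf_lt_double a01'.
have a01 : 0 <= a <= 1 by lra.
have ar01 : 0 <= a + r <= 1 by lra.
have [n0 _ Hn0] : \forall n \near \oo, (pgf_poly p n).[a + r] <= 2 * (pgf_poly p n).[a].
  have : 2 * (pgf_poly p n).[a] - (pgf_poly p n).[a + r] @[n --> \oo] --> 2 * G a - G (a + r).
    by apply: cvgB; [apply: cvgMl_tmp; exact: pgf_poly_cvg|exact: pgf_poly_cvg].
  move=> /cvgr_gt /(_ 0); rewrite subr_gt0 => /(_ Gr).
  by apply: filterS => n; rewrite subr_gt0 => /ltW.
(* The strict inequality of [pgf_lt_double] passes to the partial sums only from some index [n0]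
   on. *)
pose g n := pgf_poly p (n + n0).
have [||e e0 H] := @poly_limit_isolated_zero _ (fun x => f (x + a) - (x + a))
  (fun n => 1 - (g n \Po (1 - (g n \Po ('X + a%:P)))) - ('X + a%:P)) r 3 r0.
- move=> n i; apply: pgf_poly_iter_coef_bound; try lra.
  by apply: Hn0; rewrite /= leq_addl.
- move=> x xr; have x01 : 0 <= x + a <= 1 by move: xr; rewrite ler_norml; lra.
  under eq_fun do rewrite !(hornerD, hornerN, horner_comp, hornerC, hornerX).
  apply: cvgB; last exact: cvg_cst.
  have := pgf_poly_iter_cvg x01; rewrite -(cvg_shiftn n0); exact.
exists e => //; case: H => H; [left|right] => x /H; rewrite subrK.
  by move/eqP; rewrite subr_eq0 => /eqP.
by rewrite subr_eq0.
Qed.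

Lemma pgf_iter0 : f 0 = 0.
Proof. by rewrite /pgf_iter /pgf_compl pgf0// subr0 pgf1// subrr. Qed.

Lemma pgf_iter1 : f 1 = 1.
Proof. by rewrite /pgf_iter /pgf_compl pgf1// subrr pgf0// subr0. Qed.

(** Connectedness of ]0, 1[: by the dichotomy, [S] (f is the identity nearby) and [O] (no other
    fixed point nearby) are open and complementary in it, so one of them is everything. *)
Lemma pgf_iter_fixpoint_isolated : ~ (forall x, 0 <= x <= 1 -> f x = x) ->
  forall a, 0 < a < 1 -> exists2 e, 0 < e & forall x, 0 < `|x - a| < e -> f x != x.
Proof.
move=> fid.
pose S := [set a | exists2 e, 0 < e & forall x, `|x - a| < e -> f x = x].
pose O := [set a | exists2 e, 0 < e & forall x, 0 < `|x - a| < e -> f x != x].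
pose I := `]0, 1[%classic : set R.
have oS : open S.
  rewrite openE => a [e /= e0 He]; exists (e / 2); first by rewrite /= divr_gt0.
  move=> b /= ab; exists (e / 2); first by rewrite divr_gt0.
  move=> x xb; apply: He; move: ab xb; rewrite !ltr_norml; lra.
have oO : open O.
  rewrite openE => a [e /= e0 He]; exists e => // b /= ab.
  have [<-|anb] := eqVneq a b; first by exists e.
  (* This ball around [b] avoids [a] and stays within distance [e] of it. *)
  exists (Num.min `|a - b| (e - `|a - b|)).
    by rewrite lt_min subr_gt0 ab normr_gt0 subr_eq0 anb.
  move=> x /andP[xb]; rewrite lt_min => /andP[x1 x2]; apply: He.
  apply/andP; split.
    by rewrite normr_gt0 subr_eq0; apply: contraTneq x1 => ->; rewrite ltxx.
  rewrite (le_lt_trans (ler_distD b _ _))// [X in _ + X]distrC; lra.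
have IS : I `&` S = I `&` ~` O.
  apply/seteqP; split=> a [aI H]; split=> //.
    move: H => [e e0 He] [e' e'0 He'].
    have m0 : 0 < Num.min e e' by rewrite lt_min e0.
    have xa : `|a + Num.min e e' / 2 - a| = Num.min e e' / 2.
      by rewrite addrC addKr gtr0_norm// divr_gt0.
    have /andP[me me'] : (Num.min e e' <= e) && (Num.min e e' <= e').
      by rewrite !ge_min !lexx orbT.
    (* This point would be both fixed and not fixed. *)
    have := He' (a + Num.min e e' / 2); rewrite xa divr_gt0//= He ?eqxx.
    2: by rewrite xa; lra.
    by rewrite (_ : _ < e')//; [move=> /(_ isT)|lra].
  move: aI; rewrite /I/= in_itv/= => /pgf_iter_fixpoint_dichotomy[e e0 [|]] He.
    by exists e.
  by case: H; exists e.
have cI : connected I by apply/connected_intervalP; exact: interval_is_interval.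
have [/seteqP[_ H]|SI] := pselect (I `&` S = I).
  exfalso; apply: fid => x /andP[]; rewrite le_eqVlt => /predU1P[<- _|x0].
    exact: pgf_iter0.
  rewrite le_eqVlt => /predU1P[->|x1]; first exact: pgf_iter1.
  have /H[_ [e e0 He]] : I x by rewrite /I/= in_itv/= x0.
  by apply: He; rewrite subrr normr0.
move=> a a01; have aI : I a by rewrite /I/= in_itv.
have [//|aO] := pselect (O a).
exfalso; apply: SI; apply: cI.
- by exists a; rewrite IS; split.
- by exists S.
- by exists (~` O) => //; exact: open_closedC.
Qed.

(** Each fixed point in ]0, 1[ is the only one in some interval with rational endpoints, and there
    are countably many of these; the index [None] stands for the endpoints 0 and 1. *)
Lemma countable_fixpoints : ~ (forall x, 0 <= x <= 1 -> f x = x) ->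
  countable [set x | 0 <= x <= 1 /\ f x = x].
Proof.
move=> fid; have isol := pgf_iter_fixpoint_isolated fid.
pose D (st : rat * rat) := [set x | ratr st.1 < x < ratr st.2 /\ f x = x /\
  forall y, ratr st.1 < y < ratr st.2 -> f y = y -> y = x].
apply: (@sub_countable _ _ _ (\bigcup_(o in setT) if o is Some st then D st else [set 0; 1])).
  apply: subset_card_le => x [/andP[]]; rewrite le_eqVlt => /predU1P[<- _ _|x0].
    by exists None => //; left.
  rewrite le_eqVlt => /predU1P[->|x1 fx]; first by exists None => //; right.
  have [|e e0 He] := isol x; first by rewrite x0.
  have /rat_in_itvoo[s] : x - e < x by lra.
  rewrite in_itv/= => /andP[s1 s2].
  have /rat_in_itvoo[t] : x < x + e by lra.
  rewrite in_itv/= => /andP[t1 t2].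
  exists (Some (s, t)) => //; split; first by rewrite /= s2.
  split=> // y /= /andP[sy yt] fy; apply/eqP; apply: contraTT (eqxx y) => yx.
  rewrite -{1}fy; apply: He; rewrite normr_gt0 subr_eq0 yx/= ltr_norml; lra.
apply: bigcup_countable => [|[st|] _]; first exact: countableP; last first.
  exact: finite_set_countable.
apply: (@sub_countable _ _ _ [set get (D st)]); last exact: finite_set_countable.
apply: subset_card_le => x Dx /=.
have [gst [fg _]] := getPex (ex_intro _ x Dx).
by case: Dx => _ [_ /(_ _ gst fg)].
Qed.

End fixpoints.

(** * Limits of the iterates of an increasing map of the unit interval *)

Section iterates.
Context {R : realType}.
Variable f : R -> R.
Implicit Types x y q : R.
Hypothesis f_itv : forall x : R, 0 <= x <= 1 -> 0 <= f x <= 1.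
Hypothesis f_le : forall x y : R, 0 <= x -> x <= y -> y <= 1 -> f x <= f y.
Hypothesis f_cont : continuous (fun x => f (clamp01 x)).
Hypotheses (f0 : f 0 = 0) (f1 : f 1 = 1).

(** Clamping the argument makes the limit constant on each side of [0, 1], namely 0 on the left and
    1 on the right, as suits a distribution function. *)
Definition iter_limit (x : R) : R := limn (fun n => iter n f (clamp01 x)).
Local Notation L := iter_limit.

Lemma iter_itv n x : 0 <= x <= 1 -> 0 <= iter n f x <= 1.
Proof. by move=> x01; elim: n => // n IH; exact: f_itv. Qed.

Lemma iter_le n x y : 0 <= x -> x <= y -> y <= 1 -> iter n f x <= iter n f y.
Proof.
move=> x0 xy y1; elim: n => //= n IH; apply: f_le => //.
  by have /andP[] : 0 <= iter n f x <= 1 by apply: iter_itv; rewrite x0 (le_trans xy).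
by have /andP[] : 0 <= iter n f y <= 1 by apply: iter_itv; rewrite y1 (le_trans x0).
Qed.

Lemma iter_limit_cvg x : iter n f (clamp01 x) @[n --> \oo] --> L x.
Proof.
have c01 := clamp01_itv x; have i01 n := iter_itv n c01.
case: (leP (clamp01 x) (f (clamp01 x))) => [cf|/ltW fc].
  apply: nondecreasing_is_cvgn.
    apply/nondecreasing_seqP => n; rewrite iterSr.
    apply: iter_le => //; first by case/andP: c01.
    by case/andP: (f_itv c01).
  by exists 1 => _ [n _ <-]; case/andP: (i01 n).
apply: nonincreasing_is_cvgn.
  apply/nonincreasing_seqP => n; rewrite iterSr.
  apply: iter_le => //; last by case/andP: c01.
  by case/andP: (f_itv c01).
by exists 0 => _ [n _ <-]; case/andP: (i01 n).
Qed.

Lemma iter_limit_itv x : 0 <= L x <= 1.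
Proof.
have i01 n := iter_itv n (clamp01_itv x).
apply/andP; split.
  apply: (@ler_cvg_to _ \oo _ _ _ _ _ _ (cvg_cst 0) (@iter_limit_cvg x)).
  by apply: nearW => n; case/andP: (i01 n).
apply: ler_cvg_to (@iter_limit_cvg x) (cvg_cst (1 : R)) _.
by apply: nearW => n; case/andP: (i01 n).
Qed.

Lemma iter_limit_homo x y : x <= y -> L x <= L y.
Proof.
move=> xy; apply: ler_cvg_to (@iter_limit_cvg x) (@iter_limit_cvg y) _.
apply: nearW => n; have /andP[x0 _] := clamp01_itv x; have /andP[_ y1] := clamp01_itv y.
by apply: iter_le => //; exact: clamp01_homo.
Qed.

Lemma iter_limit_fix x : f (L x) = L x.
Proof.
have H : f (iter n f (clamp01 x)) @[n --> \oo] --> f (L x).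
  rewrite -(clamp01_id (iter_limit_itv x)).
  rewrite (_ : (fun n => _) = (fun y => f (clamp01 y)) \o (fun n => iter n f (clamp01 x))).
    exact: cvg_comp (@iter_limit_cvg x) (@f_cont (L x)).
  by apply/funext => n /=; rewrite [in RHS]clamp01_id// iter_itv// clamp01_itv.
have := @iter_limit_cvg x; rewrite -cvg_shiftS => H'.
exact: cvg_unique H H'.
Qed.

Lemma fix_iter_limit q : 0 <= q <= 1 -> f q = q -> L q = q.
Proof.
move=> q01 fq; rewrite /L clamp01_id//.
by rewrite (_ : (fun n => _) = cst q) ?lim_cst//; apply/funext; elim=> //= n ->.
Qed.

Lemma iter_limit_le0 x : x <= 0 -> L x = 0.
Proof.
move=> x0; have := @fix_iter_limit 0; rewrite lexx ler01 => /(_ isT f0).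
by rewrite /L !clamp01_le0.
Qed.

Lemma iter_limit_ge1 x : 1 <= x -> L x = 1.
Proof.
move=> x0; have := @fix_iter_limit 1; rewrite lexx ler01 => /(_ isT f1).
by rewrite /L !clamp01_ge1.
Qed.

Lemma iter_limit_comp x : 0 <= x <= 1 -> L (f x) = L x.
Proof.
move=> x01; have := @iter_limit_cvg (f x); rewrite clamp01_id ?f_itv//.
under eq_fun do rewrite -iterSr; rewrite -{1}(clamp01_id x01) => H.
have := @iter_limit_cvg x; rewrite -cvg_shiftS => H'.
exact: cvg_unique H H'.
Qed.

(** If q < f(q), continuity gives y < q with q < f(y); then L(y) <= L(q) <= L(f(y)) = L(y), while
    L(f(q)) = L(q), so L agrees at y and f(q). The case f(q) < q is symmetric. *)
Lemma iter_limit_locally_constant q : ~ (0 <= q <= 1 /\ f q = q) ->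
  exists y y', [/\ y < q, q < y' & L y = L y'].
Proof.
move=> nq; have [q0|q0] := ltP q 0.
  by exists (q - 1), 0; split; [lra|lra|rewrite !iter_limit_le0//; lra].
have [q1|q1] := ltP 1 q.
  by exists 1, (q + 1); split; [lra|lra|rewrite !iter_limit_ge1//; lra].
have fq : f q != q by apply/eqP => fq; apply: nq; rewrite q0.
have q0' : 0 < q by rewrite lt_neqAle q0 andbT; apply: contraNneq fq => <-; rewrite f0.
have q1' : q < 1 by rewrite lt_neqAle q1 andbT; apply: contraNneq fq => ->; rewrite f1.
have q01 : 0 <= q <= 1 by rewrite q0.
have cq : f (clamp01 y) @[y --> q] --> f q by rewrite -{2}(clamp01_id q01); exact: f_cont.
case: (ltgtP q (f q)) fq => // qf _.
- have /cvgr_gt/(_ _ qf)[e /= e0 He] := cq.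
  pose y := Num.max 0 (q - e / 2).
  have yq : y < q by rewrite gt_max q0' /=; lra.
  have y0 : 0 <= y by rewrite le_max lexx.
  have ye : q - e / 2 <= y by rewrite le_max lexx orbT.
  have y01 : 0 <= y <= 1 by rewrite y0; lra.
  have fy : q < f y.
    by have := He y; rewrite clamp01_id//; apply; rewrite /= ltr_norml; lra.
  exists y, (f q); split => //; rewrite (iter_limit_comp q01).
  apply/eqP; rewrite eq_le iter_limit_homo ?(ltW yq)//=.
  by rewrite -(iter_limit_comp y01) iter_limit_homo// ltW.
- have /cvgr_lt/(_ _ qf)[e /= e0 He] := cq.
  pose y := Num.min 1 (q + e / 2).
  have yq : q < y by rewrite lt_min q1' /=; lra.
  have y1 : y <= 1 by rewrite ge_min lexx.
  have ye : y <= q + e / 2 by rewrite ge_min lexx orbT.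
  have y01 : 0 <= y <= 1 by rewrite y1; lra.
  have fy : f y < q.
    by have := He y; rewrite clamp01_id//; apply; rewrite /= ltr_norml; lra.
  exists (f q), y; split => //; rewrite (iter_limit_comp q01).
  apply/eqP; rewrite eq_le iter_limit_homo ?(ltW yq)//=.
  by rewrite -(iter_limit_comp y01) iter_limit_homo// ltW.
Qed.

(* The one-sided limits L(q+) and L(q-). *)
Definition iter_limit_right q : R := inf (L @` `]q, +oo[).
Definition iter_limit_left q : R := sup (L @` `]-oo, q[).
Local Notation Lr := iter_limit_right.
Local Notation Ll := iter_limit_left.

Let has_inf_right q : has_inf (L @` `]q, +oo[).
Proof.
split; first by exists (L (q + 1)), (q + 1) => //=; rewrite in_itv/= ltrDl ltr01.
by exists 0 => _ [y _ <-]; case/andP: (iter_limit_itv y).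
Qed.

Let has_sup_left q : has_sup (L @` `]-oo, q[).
Proof.
split; first by exists (L (q - 1)), (q - 1) => //=; rewrite in_itv/= gtrBl ltr01.
by exists 1 => _ [y _ <-]; case/andP: (iter_limit_itv y).
Qed.

Lemma iter_limit_right_le q y : q < y -> Lr q <= L y.
Proof.
move=> qy; apply: ge_inf; first by case: (has_inf_right q).
by exists y => //=; rewrite in_itv/= qy.
Qed.

Lemma iter_limit_right_ge q : L q <= Lr q.
Proof.
apply: lb_le_inf; first by case: (has_inf_right q).
by move=> _ [y /=] + <-; rewrite in_itv/= andbT => /ltW; exact: iter_limit_homo.
Qed.

Lemma iter_limit_left_ge q y : y < q -> L y <= Ll q.
Proof.
move=> qy; apply: ub_le_sup; first by case: (has_sup_left q).
by exists y => //=; rewrite in_itv/= qy.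
Qed.

Lemma iter_limit_left_le q : Ll q <= L q.
Proof.
apply: ge_sup; first by case: (has_sup_left q).
by move=> _ [y /=] + <-; rewrite in_itv/= => /ltW; exact: iter_limit_homo.
Qed.

Lemma iter_limit_at_right q : L x @[x --> q^'+] --> Lr q.
Proof.
apply/cvgrPdist_lt => e e0.
have [_ [y /= + <-] ye] := inf_adherent e0 (has_inf_right q).
rewrite in_itv/= andbT => qy; rewrite -/(Lr q) in ye.
near=> x; rewrite distrC ger0_norm ?subr_ge0 ?iter_limit_right_le// ltrBlDl.
by rewrite (le_lt_trans _ ye)// iter_limit_homo// ltW.
Unshelve. all: by end_near. Qed.

Lemma iter_limit_at_left q : L x @[x --> q^'-] --> Ll q.
Proof.
apply/cvgrPdist_lt => e e0.
have [_ [y /= + <-] ye] := sup_adherent e0 (has_sup_left q).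
rewrite in_itv/= => qy; rewrite -/(Ll q) in ye.
near=> x; rewrite ger0_norm ?subr_ge0 ?iter_limit_left_ge// ltrBlDl -ltrBlDr.
by rewrite (lt_le_trans ye)// iter_limit_homo// ltW.
Unshelve. all: by end_near. Qed.

Lemma iter_limit_right_itv q : 0 <= Lr q <= 1.
Proof.
have /iter_limit_right_le := ltr_pwDr ltr01 (lexx q); have := iter_limit_right_ge q.
have := iter_limit_itv q; have := iter_limit_itv (q + 1); lra.
Qed.

Lemma iter_limit_left_itv q : 0 <= Ll q <= 1.
Proof.
have q1 : q - 1 < q by rewrite gtrBl.
have := iter_limit_left_ge q1; have := iter_limit_left_le q.
have := iter_limit_itv q; have := iter_limit_itv (q - 1); lra.
Qed.

(** L takes its values among the fixed points of f, and continuity makes limits of such values fixed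
    too. *)
Let fix_lim (F : set_system R) (u : R -> R) (l : R) : ProperFilter F ->
  0 <= l <= 1 -> L (u x) @[x --> F] --> l -> f l = l.
Proof.
move=> FF l01 H.
have H' : L (u x) @[x --> F] --> f l.
  rewrite -(clamp01_id l01) (_ : (fun x => _) = (fun y => f (clamp01 y)) \o (L \o u)).
    exact: cvg_comp H (@f_cont l).
  by apply/funext => x /=; rewrite clamp01_id ?iter_limit_fix// iter_limit_itv.
exact: cvg_unique H' H.
Qed.

Lemma iter_limit_right_fix q : f (Lr q) = Lr q.
Proof. exact: fix_lim (iter_limit_right_itv q) (@iter_limit_at_right q). Qed.

Lemma iter_limit_left_fix q : f (Ll q) = Ll q.
Proof. exact: fix_lim (iter_limit_left_itv q) (@iter_limit_at_left q). Qed.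

(** For small e > 0 the point q + e lies in [0, 1], where clamping is invisible, so the iterated
    limit in the definition is L(q+). *)
Lemma unstable_rightE q : 0 <= q -> unstable_right f q <-> q < 1 /\ q < Lr q.
Proof.
move=> q0; rewrite /unstable_right.
suff H : q < 1 -> lim (limn (fun n => iter n f (q + e)) @[e --> 0^'+]) = Lr q.
  by split=> -[q1]; rewrite (H q1).
move=> q1; apply/cvg_lim => //.
have : L (q + e) @[e --> 0^'+] --> Lr q.
  apply/cvgrPdist_lt => e e0.
  have /cvgrPdist_lt/(_ _ e0)[d d0 H] := @iter_limit_at_right q.
  exists d => // x /= xd x0; apply: H; last by rewrite ltrDl.
  by rewrite /= opprD addrA subrr.
apply: cvg_trans; apply: near_eq_cvg; near=> e.
have e1 : e < 1 - q by near: e; apply: nbhs_right_lt; rewrite subr_gt0.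
have e0 : 0 < e by [].
by rewrite /L clamp01_id//; lra.
Unshelve. all: by end_near. Qed.

Lemma unstable_leftE q : q <= 1 -> unstable_left f q <-> 0 < q /\ Ll q < q.
Proof.
move=> q1; rewrite /unstable_left.
suff H : 0 < q -> lim (limn (fun n => iter n f (q - e)) @[e --> 0^'+]) = Ll q.
  by split=> -[q0]; rewrite (H q0).
move=> q0; apply/cvg_lim => //.
have : L (q - e) @[e --> 0^'+] --> Ll q.
  apply/cvgrPdist_lt => e e0.
  have /cvgrPdist_lt/(_ _ e0)[d d0 H] := @iter_limit_at_left q.
  exists d => // x /= xd x0; apply: H; last by rewrite gtrBl.
  by rewrite /= opprB addrC subrK -normrN -sub0r.
apply: cvg_trans; apply: near_eq_cvg; near=> e.
have e1 : e < q by near: e; exact: nbhs_right_lt.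
have e0 : 0 < e by [].
by rewrite /L clamp01_id//; lra.
Unshelve. all: by end_near. Qed.

(** In the unstable case L(q+) is itself a fixed point above q, and any fixed point x > q satisfies
    x = L(x) >= L(q+). Otherwise L(q+) = q. *)
Lemma fix_aboveE q : 0 <= q <= 1 -> f q = q -> fix_above f q = Lr q.
Proof.
move=> q01 fq; have q0 : 0 <= q by case/andP: q01.
rewrite /fix_above; case: asboolP => [/(unstable_rightE q0)[q1 qLr]|nu].
  apply/eqP; rewrite eq_le; apply/andP; split.
    apply: ge_inf; first by exists q => x [_ /ltW].
    by split; rewrite ?iter_limit_right_itv ?iter_limit_right_fix.
  apply: lb_le_inf.
    by exists (Lr q); split; rewrite ?iter_limit_right_itv ?iter_limit_right_fix.
  move=> x [x01 qx fx]; rewrite -(fix_iter_limit x01 (esym fx)).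
  exact: iter_limit_right_le.
have := iter_limit_right_ge q; rewrite (fix_iter_limit q01 fq) => qLr.
apply/eqP; rewrite eq_le qLr /=; case: (ltP q 1) => [q1|q1].
  by rewrite leNgt; apply/negP => ?; apply: nu; exact/unstable_rightE.
by rewrite (le_trans _ q1)//; case/andP: (iter_limit_right_itv q).
Qed.

Lemma fix_belowE q : 0 <= q <= 1 -> f q = q -> fix_below f q = Ll q.
Proof.
move=> q01 fq; have q1 : q <= 1 by case/andP: q01.
rewrite /fix_below; case: asboolP => [/(unstable_leftE q1)[q0 qLl]|nu].
  apply/eqP; rewrite eq_le; apply/andP; split.
    apply: ge_sup.
      by exists (Ll q); split; rewrite ?iter_limit_left_itv ?iter_limit_left_fix.
    move=> x [x01 qx fx]; rewrite -(fix_iter_limit x01 (esym fx)).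
    exact: iter_limit_left_ge.
  apply: ub_le_sup; first by exists q => x [_ /ltW].
  by split; rewrite ?iter_limit_left_itv ?iter_limit_left_fix.
have := iter_limit_left_le q; rewrite (fix_iter_limit q01 fq) => qLl.
apply/eqP; rewrite eq_le qLl andbT; case: (ltP 0 q) => [q0|q0].
  by rewrite leNgt; apply/negP => ?; apply: nu; exact/unstable_leftE.
by rewrite (le_trans q0)//; case/andP: (iter_limit_left_itv q).
Qed.

(** L has no jump where it is locally constant, that is off the fixed points; at a fixed point, L(q)
    = q lies between the one-sided limits, so a jump occurs on at least one side of q. *)
Lemma unstable_fixpointsE q : unstable_fixpoints f q <-> Ll q < Lr q.
Proof.
have LL := le_trans (iter_limit_left_le q) (iter_limit_right_ge q).
have [[q01 fq]|nq] := pselect (0 <= q <= 1 /\ f q = q); last first.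
  split=> [[q01 fq _]|]; first by case: nq.
  have [y [y' [yq qy' yy']]] := iter_limit_locally_constant nq.
  have := iter_limit_left_ge yq; have := iter_limit_right_le qy'; rewrite yy'; lra.
have /andP[q0 q1] := q01; have Lq := fix_iter_limit q01 fq.
have Lrq := iter_limit_right_ge q; have Llq := iter_limit_left_le q.
split=> [[_ _ [/(unstable_rightE q0)[_]|/(unstable_leftE q1)[_]]]|LlLr]; [lra|lra|].
split=> //; have [qr|rq] := ltP q (Lr q).
  left; apply/unstable_rightE => //; split => //.
  by rewrite (lt_le_trans qr)//; case/andP: (iter_limit_right_itv q).
right; apply/unstable_leftE => //; split; last by lra.
by apply: (@le_lt_trans _ _ (Ll q)); [case/andP: (iter_limit_left_itv q)|lra].
Qed.

End iterates.

(** * Law of the limit *)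

Section random_variable_of_cdf.
Context {R : realType}.
Variable F : R -> R.
Hypotheses (F_nd : nondecreasing F) (F_rc : right_continuous F).
Hypotheses (F_Ny : F x @[x --> -oo] --> (0 : R)) (F_y : F x @[x --> +oo] --> (1 : R)).
Local Open Scope measure_display_scope.

#[local] HB.instance Definition _ := isCumulative.Build R _ R F F_nd F_rc.
#[local] HB.instance Definition _ := isCumulativeBounded.Build R 0 1 F F_Ny F_y.

Let idTR : measurableTypeR R -> R := idfun.

#[local] HB.instance Definition _ :=
  @isMeasurableFun.Build _ _ _ _ idTR (@measurable_id _ _ setT).

(** The identity map of the line under the Lebesgue-Stieltjes measure of [F]. *)
Lemma exists_random_variable_of_cdf :
  exists (d : measure_display) (T : measurableType d) (P : probability T R)
    (X : {RV P >-> R}),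
    forall x, cdf X x = (F x)%:E.
Proof.
exists _, (measurableTypeR R), (lebesgue_stieltjes_measure F), idTR.
exact: cdf_lebesgue_stieltjes_id.
Qed.

End random_variable_of_cdf.

(** * Atoms and support of a law from its distribution function *)

Section cdf_law.
Context {R : realType} {d : measure_display} {T : measurableType d}.
Context {P : probability T R}.
Variables (X : {RV P >-> R}) (F : R -> R).
Hypothesis cdfX : forall x, cdf X x = (F x)%:E.

Lemma distribution_itvoc s t : s <= t -> distribution P X `]s, t] = (F t - F s)%:E.
Proof.
move=> st; have -> : `]s, t]%classic = `]-oo, t] `\` `]-oo, s] :> set R.
  apply/seteqP; split=> x /=; rewrite !in_itv/= -?ltNge.
    by move=> /andP[sx xt]; rewrite xt; split=> //; apply/negP; rewrite -ltNge.
  by move=> [-> /negP]; rewrite -ltNge => ->.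
rewrite measureD//; last by rewrite -ge0_fin_numE// fin_num_measure.
rewrite (_ : _ `&` _ = `]-oo, s]%classic); last first.
  by apply/setIidPr => x /=; rewrite !in_itv/= => /le_trans; apply.
by rewrite EFinB -!cdfX.
Qed.

Lemma distribution_set1 q l : F x @[x --> q^'-] --> l ->
  distribution P X [set q] = (F q - l)%:E.
Proof.
move=> Fl; pose I n := `]q - n.+1%:R^-1, q]%classic : set R.
have qn n : q - n.+1%:R^-1 < q by rewrite gtrBl invr_gt0.
have H1 : distribution P X (I n) @[n --> \oo] --> distribution P X [set q].
  rewrite set1_bigcap_oc; apply: nonincreasing_cvg_mu => //.
  - rewrite -ge0_fin_numE// fin_num_measure//; exact: measurable_itv.
  - by move=> n; exact: measurable_itv.
  - by rewrite -set1_bigcap_oc.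
  - move=> n m nm; apply/subsetPset => x /=; rewrite /I/= !in_itv/= => /andP[+ ->].
    rewrite andbT; apply: le_lt_trans; rewrite lerD2l lerN2 lef_pV2 ?posrE//.
    by rewrite ler_nat.
have H2 : (F q - F (q - n.+1%:R^-1))%:E @[n --> \oo] --> (F q - l)%:E.
  apply: cvg_EFin; first by near=> n.
  apply: cvgB; first exact: cvg_cst.
  move/cvg_at_leftP : Fl; apply; split => //.
  rewrite -{2}(subr0 q); apply: cvgB; first exact: cvg_cst.
  exact: cvg_harmonic.
have HI n : distribution P X (I n) = (F q - F (q - n.+1%:R^-1))%:E.
  exact: distribution_itvoc (ltW (qn n)).
apply: cvg_unique H1 _ => //.
by rewrite (_ : (fun n => _) = (fun n => (F q - F (q - n.+1%:R^-1))%:E)) //; apply/funext.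
Unshelve. all: by end_near. Qed.

(** The complement of [A] is covered by the intervals with rational endpoints on which [F] does not
    increase: countably many null sets. *)
Lemma countable_support_discrete (A : set R) : countable A ->
  (forall x, ~ A x -> exists s t, [/\ s < x, x < t & F s = F t]) ->
  distribution P X A = 1%E.
Proof.
move=> cA HA; have mA : measurable A.
  by apply: countable_measurable; [exact: measurable_set1|exact: cA].
have F_le x y : x <= y -> F x <= F y.
  by move=> xy; rewrite -lee_fin -!cdfX; exact: cdf_nondecreasing.
pose J n := if @choice.unpickle (rat * rat)%type n is Some (s, t) then
  if F (ratr s) == F (ratr t) then `]ratr s, ratr t]%classic else set0 else set0 : set R.
have J0 : (distribution P X).-negligible (\bigcup_n J n).
  apply: negligible_bigcup => n; rewrite /J.
  case: choice.unpickle => [[s t]|]; last exact: negligible_set0.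
  case: eqP => [st|_]; last exact: negligible_set0.
  apply/negligibleP => //; case: (leP (ratr s : R) (ratr t)) => [|ts].
    by move=> /distribution_itvoc E; apply: etrans E _; rewrite st subrr.
  by rewrite set_itv_ge ?measure0// bnd_simp -leNgt ltW.
have AJ : ~` A `<=` \bigcup_n J n.
  move=> x /HA [s [t [sx xt Fst]]].
  have [s'] := rat_in_itvoo sx; rewrite in_itv/= => /andP[ss' s'x].
  have [t'] := rat_in_itvoo xt; rewrite in_itv/= => /andP[xt' t't].
  exists (choice.pickle (s', t')); first exact: I.
  rewrite /J choice.pickleK.
  have -> : F (ratr s') == F (ratr t').
    rewrite eq_le F_le ?(ltW (lt_trans s'x xt'))//=.
    apply: (@le_trans _ _ (F t)); first exact: F_le (ltW t't).
    by rewrite -Fst F_le// ltW.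
  by rewrite /= in_itv/= s'x ltW.
have : distribution P X (~` A) = 0%E.
  by apply/(negligibleP _ (measurableC mA)); exact: negligibleS J0.
have := probability_setC (distribution P X) (measurableC mA); rewrite setCK => E H.
by apply: etrans E _; apply: etrans (congr1 (fun z => 1 - z)%E H) _; rewrite sube0.
Qed.

End cdf_law.

(** The rays ]x, +oo[, complements of those in the hypothesis, generate the Borel sets and are
    stable under intersection. *)
Lemma eq_probability_itvNy {R : realType} (mu nu : probability R R) :
  (forall x, mu `]-oo, x]%classic = nu `]-oo, x]%classic) ->
  forall A, measurable A -> mu A = nu A.
Proof.
move=> munu; have itvC (m : probability R R) x :
    m `]x, +oo[%classic = (1 - m `]-oo, x]%classic)%E.
  rewrite -probability_setC; last exact: measurable_itv.
  by rewrite setCitvl.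
move=> A mA; apply: (@measure_unique _ R R (@RGenOInfty.G R)
  (fun n => `](- n%:R), +oo[%classic) _ _ _ _ mu nu).
- exact: RGenOInfty.measurableE.
- move=> _ _ [x ->] [y ->]; exists (Num.max x y).
  by apply/seteqP; split=> z /=; rewrite !in_itv/= !andbT gt_max; [case=> -> ->|case/andP].
- by move=> n; exists (- n%:R).
- apply/seteqP; split=> // x _; exists (Num.truncn (- x)).+1 => //=.
  by rewrite in_itv/= andbT ltrNl truncnS_gt.
- by move=> _ [x ->]; apply: etrans (itvC mu x) _; rewrite munu; exact: esym (itvC nu x).
- by move=> n; rewrite -ge0_fin_numE// fin_num_measure//; exact: measurable_itv.
- exact: mA.
Qed.

Section uniform01_cdf.
Context {R : realType} {d : measure_display} {T : measurableType d}.
Context {P : probability T R}.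

(* [uniform_prob] lives on the copy [measurableTypeR R] of [R]. *)
Let idTR : measurableTypeR R -> R := idfun.

#[local] HB.instance Definition _ :=
  @isMeasurableFun.Build _ _ _ _ idTR (@measurable_id _ _ setT).

Lemma uniform01_cdf (X : {RV P >-> R}) :
  (forall x, cdf X x = (clamp01 x)%:E) -> uniform01 P X.
Proof.
move=> cX A mA; pose Y : {RV (uniform_prob (@ltr01 R)) >-> R} := idTR.
apply: (eq_probability_itvNy (mu := distribution P X) (nu := distribution _ Y)) mA => x.
by rewrite [LHS]cX -uniform_prob_itvNy.
Qed.

End uniform01_cdf.

(** * The limit variable W and its law *)

Section limit_law.
Context {R : realType}.
Variable p : nat -> R.
Hypothesis hp : offspring_pmf p.
Local Notation f := (pgf_iter p).

Let f_itv (x : R) : 0 <= x <= 1 -> 0 <= f x <= 1 := @pgf_iter_itv _ _ hp x.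

Lemma pgf_iter_le (x y : R) : 0 <= x -> x <= y -> y <= 1 -> f x <= f y.
Proof.
move=> x0 xy y1; rewrite lerB//.
have x01 : 0 <= x <= 1 by lra.
have y01 : 0 <= y <= 1 by lra.
have /andP[_ ?] := pgf_compl_itv hp x01; have /andP[? _] := pgf_compl_itv hp y01.
by apply: pgf_le => //; rewrite lerB// pgf_le.
Qed.

Lemma continuous_pgf_iter_clamp01 : continuous (fun x : R => f (clamp01 x)).
Proof.
(* A second clamp can be inserted between the two factors, since the inner value already lies in
   [0, 1]. *)
have -> : (fun x : R => f (clamp01 x)) =
    (fun x => 1 - pgf p (clamp01 x)) \o (fun x => 1 - pgf p (clamp01 x)).
  apply/funext => x /=; congr (1 - pgf p _); rewrite [RHS]clamp01_id//.
  exact: (pgf_compl_itv hp (clamp01_itv x)).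
have c1 : continuous (fun x : R => 1 - pgf p (clamp01 x)).
  by move=> x; apply: cvgB; [exact: cvg_cst|exact: continuous_pgf_clamp].
by move=> x; apply: continuous_comp; exact: c1.
Qed.

Let f_le := pgf_iter_le.
Let f_cont := continuous_pgf_iter_clamp01.
Let f0 : f 0 = 0 := pgf_iter0 hp.
Let f1 : f 1 = 1 := pgf_iter1 hp.

Local Notation L := (iter_limit f).
Local Notation Lr := (iter_limit_right f).
Local Notation Ll := (iter_limit_left f).

Lemma iter_limit_right_le_left x y : x < y -> Lr x <= Ll y.
Proof.
move=> xy; have [xm my] := midf_lt xy.
apply: (@le_trans _ _ (L ((x + y) / 2))).
  by apply: iter_limit_right_le => //.
by apply: iter_limit_left_ge => //.
Qed.

Lemma iter_limit_right_homo : nondecreasing Lr.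
Proof.
move=> x y; rewrite le_eqVlt => /predU1P[->//|xy].
apply: (le_trans (iter_limit_right_le_left xy)).
exact: le_trans (iter_limit_left_le f_itv f_le y) (iter_limit_right_ge f_itv f_le y).
Qed.

Lemma iter_limit_right_continuous : right_continuous Lr.
Proof.
move=> q; apply/cvgrPdist_lt => e e0.
have /cvgrPdist_lt/(_ _ e0)[d /= d0 H] := @iter_limit_at_right _ _ f_itv f_le q.
have qd : q < q + d / 2 by rewrite ltrDl divr_gt0.
have := H (q + d / 2); rewrite /= opprD addrA subrr sub0r normrN gtr0_norm ?divr_gt0//.
rewrite gtr_pMr// invf_lt1// ltr1n => /(_ isT qd) He.
near=> x.
have qx : q < x by [].
have xd : x < q + d / 2 by near: x; exact: nbhs_right_lt.
have h1 := iter_limit_right_le f_itv f_le xd.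
have h2 := iter_limit_right_homo (ltW qx).
by move: He; rewrite !ltr_norml; lra.
Unshelve. all: by end_near. Qed.

(** Squeeze L(x) <= L(x+) <= L(q-) for x < q: passing to the right-continuous version leaves the
    left limits unchanged. *)
Lemma iter_limit_right_at_left q : Lr x @[x --> q^'-] --> Ll q.
Proof.
apply: (@squeeze_cvgr _ _ _ _ L (cst (Ll q))); last 2 first.
- exact: iter_limit_at_left.
- exact: cvg_cst.
near=> x; rewrite iter_limit_right_ge//= iter_limit_right_le_left//.
Unshelve. all: by end_near. Qed.

Lemma exists_limit_variable :
  exists (d : measure_display) (T : measurableType d) (P : probability T R)
    (W : {RV P >-> R}),
    forall x, cdf W x = (Lr x)%:E.
Proof.
apply: exists_random_variable_of_cdf.
- exact: iter_limit_right_homo.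
- exact: iter_limit_right_continuous.
- apply: cvg_near_cst; near=> x.
  have x0 : x < 0 by near: x; apply: nbhs_ninfty_lt; exact: real0.
  apply/eqP; rewrite eq_le -{1}(iter_limit_le0 f0 (lexx 0)) iter_limit_right_le//=.
  by case/andP: (iter_limit_right_itv f_itv f_le x).
- apply: cvg_near_cst; near=> x.
  have x1 : 1 <= x by near: x; apply: nbhs_pinfty_ge; exact: real1.
  apply/eqP; rewrite eq_le -{2}(iter_limit_ge1 f1 x1) iter_limit_right_ge// andbT.
  by case/andP: (iter_limit_right_itv f_itv f_le x).
Unshelve. all: by end_near. Qed.

Section law.
Context {d : measure_display} {T : measurableType d} {P : probability T R}.
Variable W : {RV P >-> R}.
Hypothesis cdfW : forall x, cdf W x = (Lr x)%:E.

(** The distribution functions of W_2n converge to L, whereas W has L(x+). At a continuity point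
    L(x+) = L(x-) <= L(x), so the two agree. *)
Lemma continuous_cdf_iter_limit x : {for x, continuous (cdf W)} -> L x = Lr x.
Proof.
move=> cx; apply/eqP; rewrite eq_le iter_limit_right_ge//=.
have H : Lr y @[y --> x] --> Lr x.
  have /fine_cvg : cdf W y @[y --> x] --> (Lr x)%:E by rewrite -cdfW; exact: cx.
  by apply: cvg_trans; apply: near_eq_cvg; apply: nearW => y /=; rewrite cdfW.
rewrite (cvg_unique _ (cvg_at_left_filter H) (@iter_limit_right_at_left x))//.
exact: iter_limit_left_le.
Qed.

Lemma limit_law_set1 q : distribution P W [set q] = (Lr q - Ll q)%:E.
Proof. by apply: (distribution_set1 cdfW); exact: iter_limit_right_at_left. Qed.

Lemma limit_law_discrete : ~ (forall x, 0 <= x <= 1 -> f x = x) -> discrete_law P W.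
Proof.
move=> fid; exists [set x | 0 <= x <= 1 /\ f x = x]; first exact: countable_fixpoints.
apply: (countable_support_discrete cdfW); first exact: countable_fixpoints.
move=> x /(iter_limit_locally_constant f_itv f_le f_cont f0 f1)[y [y' [yx xy' yy']]].
(* Midpoints are taken because L(t+) <= L(y') needs t strictly below y'. *)
have [ym mx] := midf_lt yx; exists ((y + x) / 2), ((x + y') / 2).
have [xm my'] := midf_lt xy'.
split => //; apply/eqP; rewrite eq_le iter_limit_right_homo ?(ltW (lt_trans mx xm))//=.
have := iter_limit_right_le f_itv f_le my'.
have := iter_limit_right_ge f_itv f_le ((y + x) / 2).
have := iter_limit_homo f_itv f_le (ltW ym); rewrite yy'; lra.
Qed.

End law.
End limit_law.

Theorem theorem1p2 (R : realType) (p : nat -> R) (hp : offspring_pmf p)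
    (d : measure_display) (T : measurableType d) (P : probability T R)
    (N : seq nat -> {RV P >-> nat}) (U : seq nat -> {RV P >-> R})
    (hNU : minimax_data N U p) :
  let f := pgf_iter p in
  let f_is_id := forall x : R, 0 <= x <= 1 -> f x = x in
  exists (d' : measure_display) (T' : measurableType d')
    (P' : probability T' R) (W : {RV P' >-> R}),
  [/\ cvg_in_distribution P (fun n => minimax N U n) P' W,
      f_is_id -> forall n, uniform01 P (minimax N U n) &
      ~ f_is_id ->
      [/\ discrete_law P' W,
          [set q | distribution P' W [set q] != 0%E] = unstable_fixpoints f &
          forall q, unstable_fixpoints f q ->
            distribution P' W [set q] = (fix_above f q - fix_below f q)%:E]].
Proof.
move=> f fid; have [d' [T' [P' [W cdfW]]]] := exists_limit_variable hp.
exists d', T', P', W; split.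
- move=> x cx; rewrite cdfW -(continuous_cdf_iter_limit hp cdfW cx).
  under eq_fun do rewrite (cdf_minimax hp hNU).
  apply: cvg_EFin; first exact: nearW.
  exact: iter_limit_cvg (pgf_iter_itv hp) (pgf_iter_le hp) x.
- move=> f_id n; apply: uniform01_cdf => x; rewrite (cdf_minimax hp hNU).
  by congr EFin; elim: n => [//|n IH] /=; rewrite IH; exact: f_id (clamp01_itv x).
- move=> fnid; have uE := unstable_fixpointsE (pgf_iter_itv hp) (pgf_iter_le hp)
    (continuous_pgf_iter_clamp01 hp) (pgf_iter0 hp) (pgf_iter1 hp).
  split; first exact: (limit_law_discrete hp cdfW fnid).
    (* The mass at [q] is the jump of L there, and [uE] identifies positive jumps with
       instability. *)
    apply/seteqP; split=> q /=; rewrite (limit_law_set1 hp cdfW).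
      move=> LL; apply/uE; rewrite lt_neqAle; apply/andP; split.
        by move: LL; rewrite eqe subr_eq0 eq_sym.
      exact: le_trans (iter_limit_left_le (pgf_iter_itv hp) (pgf_iter_le hp) q)
        (iter_limit_right_ge (pgf_iter_itv hp) (pgf_iter_le hp) q).
    by move=> /uE; rewrite eqe subr_eq0 => /gt_eqF ->.
  move=> q [q01 fq _]; rewrite (limit_law_set1 hp cdfW).
  rewrite (fix_aboveE (pgf_iter_itv hp) (pgf_iter_le hp) (continuous_pgf_iter_clamp01 hp)
    q01 fq).
  by rewrite (fix_belowE (pgf_iter_itv hp) (pgf_iter_le hp) (continuous_pgf_iter_clamp01 hp)
    q01 fq).
Qed.
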